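(* For every integer $k\ge 1$, the set of nonsingular $2^k\times 2^k$ matrices that are character matrices of $k$-bit matchgates forms a group under matrix multiplication.
   Context: A weighted undirected graph $G=(V,E,W)$ with $V=\{1,\dots,n\}$ is represented by its skew-symmetric adjacency matrix $M$: $M(i,j)=w(i,j)$ if $i<j$, $M(i,j)=-w(i,j)$ if $i>j$, $M(i,i)=0$ (absent edges have weight $0$). The Pfaffian $\mathrm{Pf}(M)$ is $0$ if $n$ is odd, $1$ if $n=0$, and for $n=2m>0$ equals $\sum_\pi \epsilon_\pi w(i_1,i_2)\cdots w(i_{2m-1},i_{2m})$ over permutations $\pi=[i_1,\dots,i_{2m}]$ with $i_1<i_2,\dots,i_{2m-1}<i_{2m}$ and $i_1<i_3<\dots<i_{2m-1}$, $\epsilon_\pi$ the sign of $\pi$. For a set $T\subseteq V$ of omittable nodes, the Pfaffian sum $\mathrm{PfS}(G)=\sum_{A\subseteq T}\mathrm{Pf}(M[A])$, where $M[A]$ deletes rows and columns indexed by $A$ (i.e. a signed sum over matchings saturating all non-omittable nodes). A matchgate $\Gamma=(G,X,Y,T)$ consists of a weighted graph $G$ on $V=\{1,\dots,n\}$, pairwise disjoint sets of input nodes $X$, output nodes $Y$ and omittable nodes $T$; it is $k$-bit if $|X|=|Y|=k$, with $X=\{1,\dots,k\}$ and $Y=\{n-k+1,\dots,n\}$. Each node of $X\cup Y$ has one external edge, whose other endpoint has index smaller than all of $V$ for input nodes and larger than all of $V$ for output nodes. For $Z\subseteq X\cup Y$, the character is $\chi(\Gamma,Z)=\mu(\Gamma,Z)\,\mathrm{PfS}(G-Z)$,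 where $G-Z$ deletes the vertices of $Z$ (the nodes of $Z$ are regarded as matched by their external edges) and $\mu(\Gamma,Z)\in\{\pm1\}$ is the parity of the number of overlaps between edges of the matching in $G-Z$ and the external edges of nodes in $Z$ (two edges $(a,b),(c,d)$ with $a<b$, $c<d$ overlap iff $a<c<b<d$ or $c<a<d<b$). The character matrix $\chi(\Gamma)$ is the $2^k\times 2^k$ matrix whose entry in row $i_1i_2\cdots i_k$ and column $i_ni_{n-1}\cdots i_{n-k+1}$ (binary strings read as numbers in $\{0,\dots,2^k-1\}$) is $\chi(\Gamma,X'\cup Y')$ with $X'=\{j\in X: i_j=1\}$, $Y'=\{j\in Y: i_j=1\}$. A matrix is a (k-bit) character matrix if it is $\chi(\Gamma)$ for some $k$-bit matchgate $\Gamma$. *)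

(* Defs.v *)
From HB Require Import structures.
From mathcomp Require Import all_boot all_order all_fingroup all_algebra.

Set Implicit Arguments.
Unset Strict Implicit.
Unset Printing Implicit Defensive.

Import GRing.Theory.
Local Open Scope ring_scope.

(* Vertices 1, ..., n of the mathematical text are the ordinals 0, ..., n-1. *)

Record wgraph (F : fieldType) (n : nat) := WGraph {
  edge : rel 'I_n;
  edge_sym : symmetric edge;
  edge_irr : irreflexive edge;
  weight : 'I_n -> 'I_n -> F;
  weight_sym : forall i j, weight i j = weight j i;
  weight_absent : forall i j, ~~ edge i j -> weight i j = 0
}.

Definition skew_adj (F : fieldType) (n : nat) (G : wgraph F n) : 'M[F]_n :=
  \matrix_(i, j) (if (i < j)%N then weight G i j
                  else if (j < i)%N then - weight G i j
                  else 0).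

(* The permutation s stands for the word [s 0, s 1, ..., s (n-1)]; positions
   are 0-based, so the pairs of the word start at the even positions. *)
Definition pf_perm (n : nat) (s : 'S_n) : bool :=
  [forall i : 'I_n, forall j : 'I_n,
     (~~ odd i && ((j == i.+1 :> nat) || (j == i.+2 :> nat))) ==> (s i < s j)%N].

Definition Pf (F : fieldType) (n : nat) (M : 'M[F]_n) : F :=
  if odd n then 0
  else \sum_(s : 'S_n | pf_perm s)
         (-1) ^+ s *
         \prod_(i < n | ~~ odd i) \prod_(j < n | j == i.+1 :> nat) M (s i) (s j).

(* [enum_val] enumerates the remaining indices in increasing order. *)
Definition delete_mx (F : fieldType) (n : nat) (M : 'M[F]_n) (A : {set 'I_n}) :
    'M[F]_#|~: A| :=
  \matrix_(i, j) M (enum_val i) (enum_val j).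

(* Pfaffian sum of G - Z with omittable nodes T. *)
Definition PfS (F : fieldType) (n : nat) (G : wgraph F n) (T Z : {set 'I_n}) : F :=
  \sum_(A : {set 'I_n} | A \subset T) Pf (delete_mx (skew_adj G) (Z :|: A)).

Record matchgate (F : fieldType) := Matchgate {
  size_V : nat;
  graph : wgraph F size_V;
  inputs : {set 'I_size_V};
  outputs : {set 'I_size_V};
  omittable : {set 'I_size_V};
  disj_in_out : [disjoint inputs & outputs];
  disj_in_omit : [disjoint inputs & omittable];
  disj_out_omit : [disjoint outputs & omittable]
}.

Definition kbit (F : fieldType) (k : nat) (Gamma : matchgate F) : Prop :=
  [/\ #|inputs Gamma| = k, #|outputs Gamma| = k,
      inputs Gamma = [set i : 'I_(size_V Gamma) | (i < k)%N]
    & outputs Gamma = [set i : 'I_(size_V Gamma) | (size_V Gamma - k <= i)%N]].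

(* E, given as pairs (a, b) with a < b, is a matching of G - Z saturating all
   its non-omittable nodes. *)
Definition is_matching (F : fieldType) (n : nat) (G : wgraph F n)
    (T Z : {set 'I_n}) (E : {set 'I_n * 'I_n}) : bool :=
  [&& [forall e in E, [&& (e.1 < e.2)%N, edge G e.1 e.2,
                          e.1 \notin Z & e.2 \notin Z]],
      [forall v : 'I_n, (#|[set e in E | (v == e.1) || (v == e.2)]| <= 1)%N]
    & [forall v : 'I_n, (v \notin Z :|: T) ==>
         [exists e in E, (v == e.1) || (v == e.2)]]].

Definition overlap (e f : nat * nat) : bool :=
  (e.1 < f.1 < e.2)%N && (e.2 < f.2)%N || (f.1 < e.1 < f.2)%N && (f.2 < e.2)%N.

(* Node v sits at position v + 1, the outer endpoints of the external edges at
   position 0 (inputs) and n + 1 (outputs).  Sharing an outer endpoint is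
   harmless: external edges are compared only with internal ones. *)
Definition internal_edge (n : nat) (e : 'I_n * 'I_n) : nat * nat :=
  (e.1.+1, e.2.+1).

Definition external_edge (F : fieldType) (Gamma : matchgate F)
    (z : 'I_(size_V Gamma)) : nat * nat :=
  if z \in inputs Gamma then (0, z.+1)%N else (z.+1, (size_V Gamma).+1)%N.

Definition overlaps (F : fieldType) (Gamma : matchgate F)
    (Z : {set 'I_(size_V Gamma)})
    (E : {set 'I_(size_V Gamma) * 'I_(size_V Gamma)}) : nat :=
  \sum_(e in E) \sum_(z in Z) overlap (internal_edge e) (external_edge z).

(* For a k-bit matchgate the parity does not depend on the matching picked: the
   nodes before an input node (after an output node) are all inputs (outputs),
   hence saturated unless in Z.  If there is no matching then PfS (G - Z) = 0
   and the value chosen here is irrelevant. *)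
Definition mu (F : fieldType) (Gamma : matchgate F)
    (Z : {set 'I_(size_V Gamma)}) : F :=
  if [pick E | is_matching (graph Gamma) (omittable Gamma) Z E] is Some E
  then (-1) ^+ overlaps Z E else 1.

Definition character (F : fieldType) (Gamma : matchgate F)
    (Z : {set 'I_(size_V Gamma)}) : F :=
  mu Z * PfS (graph Gamma) (omittable Gamma) Z.

(* Digit number t, from the left and starting at t = 0, of the k-digit binary
   expansion of a. *)
Definition bdigit (k a t : nat) : bool := odd (a %/ 2 ^ (k.-1 - t)).

(* The column string i_n i_(n-1) ... i_(n-k+1) lists the output nodes in
   decreasing order, whence [rev_ord]. *)
Definition character_mx (F : fieldType) (k : nat) (Gamma : matchgate F) :
    'M[F]_(2 ^ k) :=
  \matrix_(r, c)
    character ([set j in inputs Gamma | bdigit k r j]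
               :|: [set j in outputs Gamma | bdigit k c (rev_ord j)]).

Definition is_character_mx (F : fieldType) (k : nat) (A : 'M[F]_(2 ^ k)) : Prop :=
  exists Gamma : matchgate F, kbit k Gamma /\ A = character_mx k Gamma.

Definition forms_group (U : Type) (op : U -> U -> U) (S : U -> Prop) : Prop :=
  [/\ forall x y, S x -> S y -> S (op x y),
      forall x y z, S x -> S y -> S z -> op x (op y z) = op (op x y) z
    & exists e, [/\ S e,
        forall x, S x -> op e x = x /\ op x e = x
      & forall x, S x -> exists y, [/\ S y, op x y = e & op y x = e]]].

(* Main.v *)
Require Import Defs.
From mathcomp Require Import all_boot all_order all_fingroup all_algebra.
From mathcomp Require Import zify ring.

Set Implicit Arguments.
Unset Strict Implicit.
Unset Printing Implicit Defensive.

Import GRing.Theory.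
Local Open Scope ring_scope.

(* For a function g on the subsets of a finite ordered set, consider the matchgate
   identities: for all P and Q with symmetric difference D,
     sum_(j in D) (-1)^#{i in D | i < j} g(P + j) g(Q + j) = [#|D| odd] g(P) g(Q),
   where "+ j" toggles the membership of j.  Pfaffian minors of a skew matrix satisfy
   them with right-hand side 0 (Pluecker relations for Pfaffians); summing over the
   omitted nodes creates the right-hand side, and the sign mu is what turns the order
   of V back into the standard one.
   Read on matrix entries, the identities say that B |-> A B A^T commutes with a fixed
   linear operator on matrices, a condition stable under products and inverses.
   Conversely, a function satisfying them is determined by its values at distance at
   most 2 from any set S0 where it does not vanish, and such values can be prescribed
   at will by an explicit matchgate.  So a nonsingular matrix is a character matrix
   iff it satisfies the identities. *)

(** * Expansion of the Pfaffian along the first row *)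

(** Closure under inverses shapes the argument: no gate for an inverse is in sight, whereas
    commuting with a fixed operator passes to the inverse formally. An identity for P and Q mixes
    rows and columns, and three facts separate them: the sum over D splits into a row half and a
    column half; the reversed order of the columns gives both halves the same kind of sign; and the
    parity indicator of D is, up to a sign, the difference of those of its two halves. In the
    converse, nonsingularity is used to find a nonzero entry in the row indexed by the empty set.
    Then no row port lies in S0, and the edge attached to one of them (it exists because k >= 1)
    carries a weight that scales the gate to the value prescribed at S0. The field is arbitrary, so
    antisymmetric sums are cancelled pair by pair rather than by dividing by 2. *)

Lemma Pf_odd (F : fieldType) n (M : 'M[F]_n) : odd n -> Pf M = 0.
Proof. by rewrite /Pf => ->. Qed.

Lemma Pf0 (F : fieldType) (M : 'M[F]_0) : Pf M = 1.
Proof.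
rewrite /Pf /= (big_pred1 1%g) => [|s].
  by rewrite odd_perm1 expr0 mul1r big_ord0.
have -> : s = 1%g by apply/permP; case.
rewrite /= eqxx.
by apply/forallP; case.
Qed.

Lemma pf_perm_lt n (s : 'S_n) (i j : 'I_n) :
  pf_perm s -> ~~ odd i -> (j == i.+1 :> nat) || (j == i.+2 :> nat) ->
  (s i < s j)%N.
Proof. by move=> /forallP/(_ i)/forallP/(_ j)/implyP h oi ij; apply: h; rewrite oi. Qed.

(** Every position is reached from position 0 by increasing steps: an odd one from its predecessor,
    an even one from two places before. Hence [s ord0] is the least value. *)
Lemma pf_perm_fix0 n (s : 'S_n.+1) : pf_perm s -> s ord0 = ord0.
Proof.
move=> hs.
have lt0 m (i : 'I_n.+1) : i = m :> nat -> i != ord0 -> (s ord0 < s i)%N.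
  elim/ltn_ind: m i => m IH i im i0.
  have m0 : (0 < m)%N by rewrite -im lt0n.
  have im0 : (m < n.+1)%N by rewrite -im; exact: ltn_ord.
  have im1 : (m.-1 < n.+1)%N by lia.
  have im2 : (m.-2 < n.+1)%N by lia.
  case om : (odd m).
    have h : (s (Ordinal im1) < s i)%N by apply: pf_perm_lt => //=; lia.
    have [e|ne] := eqVneq (Ordinal im1) ord0; first by rewrite e in h.
    by apply: ltn_trans h; apply: (IH m.-1) => //=; lia.
  have m1 : (1 < m)%N by lia.
  have h : (s (Ordinal im2) < s i)%N.
    by apply: pf_perm_lt => //=; lia.
  have [e|ne] := eqVneq (Ordinal im2) ord0; first by rewrite e in h.
  by apply: ltn_trans h; apply: (IH m.-2) => //=; lia.
have e := permKV s ord0; have [e0|ne] := eqVneq ((s^-1)%g ord0) ord0.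
  by rewrite -{1}e0.
by have := lt0 _ _ erefl ne; rewrite e ltn0.
Qed.

(** Puts the pair [(0, j+1)] in front of the word of [s], whose letters are relabelled increasingly
    by the remaining vertices. *)
Definition lift2_perm n (j : 'I_n.+1) (s : 'S_n) : 'S_n.+2 :=
  lift_perm ord0 ord0 (lift_perm ord0 j s).

Lemma lift2_perm0 n (j : 'I_n.+1) s : lift2_perm j s ord0 = ord0.
Proof. exact: lift_perm_id. Qed.

Lemma lift2_perm1 n (j : 'I_n.+1) s :
  lift2_perm j s (lift ord0 ord0) = lift ord0 j.
Proof. by rewrite lift_perm_lift lift_perm_id. Qed.

Lemma lift2_perm_lift n (j : 'I_n.+1) s i :
  lift2_perm j s (lift ord0 (lift ord0 i)) = lift ord0 (lift j (s i)).
Proof. by rewrite !lift_perm_lift. Qed.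

(** Relabelling by [lift] is increasing, so the old constraints persist. The new ones start from
    position 0, where the value is 0; position 1 is odd and imposes none. *)
Lemma pf_perm_lift2 n (j : 'I_n.+1) (s : 'S_n) :
  pf_perm (lift2_perm j s) = pf_perm s.
Proof.
apply/idP/idP=> hs.
  apply/forallP=> a; apply/forallP=> b; apply/implyP=> /andP[oa ab].
  have := @pf_perm_lt _ _ (lift ord0 (lift ord0 a)) (lift ord0 (lift ord0 b)) hs.
  rewrite !lift2_perm_lift !lift0 /= negbK => /(_ oa ab).
  by rewrite /bump; lia.
apply/forallP=> a; apply/forallP=> b; apply/implyP=> /andP[oa ab].
case: (unliftP ord0 a) oa ab => [a1|] ->; last first.
  rewrite lift2_perm0 => _ b12; rewrite lt0n; apply/negP=> /eqP e.
  have : lift2_perm j s b = lift2_perm j s ord0.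
    by apply: val_inj; rewrite lift2_perm0.
  by move/perm_inj=> e0; rewrite e0 in b12.
case: (unliftP ord0 a1) => [a2|] -> //; rewrite !lift0 /= negbK => oa.
case: (unliftP ord0 b) => [b1|] -> //; case: (unliftP ord0 b1) => [b2|] -> //.
rewrite !lift0 !lift2_perm_lift !lift0 => ab.
have := @pf_perm_lt _ _ a2 b2 hs oa ab.
by rewrite /= /bump; lia.
Qed.

Lemma lift_perm_bij n (j : 'I_n.+1) :
  {on [pred s : 'S_n.+1 | s ord0 == j], bijective (lift_perm ord0 j)}.
Proof.
(* [ulsf i s] is [s] with [i] removed from its source and [s i] from its target; at [i = ord0] it
   inverts [lift_perm]. *)
pose ulsf i (s : 'S_n.+1) k := odflt k (unlift (s i) (s (lift i k))).
have ulsfK i (s : 'S_n.+1) k: lift (s i) (ulsf i s k) = s (lift i k).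
  rewrite /ulsf; have := neq_lift i k.
  by rewrite -(can_eq (permK s)) => /unlift_some[] ? ? ->.
have inj_ulsf : injective (ulsf ord0 _).
  move=> s; apply: can_inj (ulsf (s ord0) s^-1%g) _ => k'.
  by rewrite {1}/ulsf ulsfK !permK liftK.
exists (fun s => perm (inj_ulsf s)) => [s _ | s].
  by apply/permP=> k'; rewrite permE /ulsf lift_perm_lift lift_perm_id liftK.
rewrite inE => /eqP si0; apply/permP=> k.
case: (unliftP ord0 k) => [k'|] ->; rewrite ?lift_perm_id //.
by rewrite lift_perm_lift -si0 permE ulsfK.
Qed.

Lemma Pf_expand (F : fieldType) n (M : 'M[F]_n.+2) :
  Pf M = \sum_(j < n.+1) (-1) ^+ j * M ord0 (lift ord0 j) *
    Pf (\matrix_(a < n, b < n)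
          M (lift ord0 (lift j a)) (lift ord0 (lift j b))).
Proof.
rewrite {1}/Pf /= negbK; case: ifPn => on.
  by rewrite big1 // => j _; rewrite Pf_odd ?mulr0.
(* The first letter is forced to be 0, so the words can be classified by their second letter. *)
rewrite (eq_bigl (fun s : 'S_n.+2 => (s ord0 == ord0) && pf_perm s)); last first.
  by move=> s; case hs : (pf_perm s); rewrite ?andbF // pf_perm_fix0 ?eqxx.
rewrite (reindex (lift_perm ord0 ord0)) /=; last first.
  have [g h1 h2] := lift_perm_bij (ord0 : 'I_n.+2).
  by exists g => s; rewrite !inE => /andP[h _]; [apply: h1 | apply: h2].
rewrite (partition_big (fun s : 'S_n.+1 => s ord0) predT) //=.
apply: eq_bigr => j _.
rewrite (reindex (lift_perm ord0 j)) /=; last first.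
  have [g h1 h2] := lift_perm_bij j.
  by exists g => s; rewrite !inE => /andP[_ h]; [apply: h1 | apply: h2].
rewrite /Pf (negPf on) big_distrr /=; apply: eq_big => s.
  by rewrite !lift_perm_id !eqxx andbT -/(lift2_perm j s) pf_perm_lift2.
move=> _; rewrite -/(lift2_perm j s) /lift2_perm !odd_lift_perm /=.
rewrite signr_addb signr_odd -!mulrA; congr (_ * _); rewrite mulrCA; congr (_ * _).
rewrite big_mkcond big_ord_recl /=; congr (_ * _).
  rewrite (big_pred1 (lift ord0 ord0)) => [|b].
    by rewrite -/(lift2_perm j s) lift2_perm0 lift2_perm1.
  by rewrite /= -val_eqE.
rewrite big_ord_recl /= mul1r -big_mkcond /=; apply: eq_big => [i|i _].
  by rewrite /bump /= !negbK.
rewrite [LHS]big_mkcond !big_ord_recl /= !mul1r -big_mkcond /=.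
apply: eq_bigr => b _.
by rewrite mxE -/(lift2_perm j s) !lift2_perm_lift.
Qed.

(** * Symmetric differences, signs and Pfaffian minors *)

Section SymmetricDifference.
Variable T : finType.
Implicit Types (P Q S : {set T}) (i j : T).

Definition tog j S := [set x | (x \in S) (+) (x == j)].
Definition sd P Q := [set x | (x \in P) (+) (x \in Q)].

Lemma in_tog x j S : (x \in tog j S) = (x \in S) (+) (x == j).
Proof. by rewrite inE. Qed.

Lemma in_sd x P Q : (x \in sd P Q) = (x \in P) (+) (x \in Q).
Proof. by rewrite inE. Qed.

Lemma togK j : involutive (tog j).
Proof. by move=> S; apply/setP=> x; rewrite !inE -addbA addbb addbF. Qed.

Lemma togC i j S : tog i (tog j S) = tog j (tog i S).
Proof. by apply/setP=> x; rewrite !inE addbAC. Qed.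

Lemma tog_sdl j P Q : sd (tog j P) Q = tog j (sd P Q).
Proof. by apply/setP=> x; rewrite !inE addbAC. Qed.

Lemma tog_sdr j P Q : sd P (tog j Q) = tog j (sd P Q).
Proof. by apply/setP=> x; rewrite !inE addbA. Qed.

Lemma sd_tog j P Q : sd (tog j P) (tog j Q) = sd P Q.
Proof. by rewrite tog_sdl tog_sdr togK. Qed.

Lemma sdC P Q : sd P Q = sd Q P.
Proof. by apply/setP=> x; rewrite !inE addbC. Qed.

Lemma sdKl P Q : sd P (sd P Q) = Q.
Proof. by apply/setP=> x; rewrite !inE addbA addbb. Qed.

Lemma tog_in j S : j \in S -> tog j S = S :\ j.
Proof.
by move=> jS; apply/setP=> x; rewrite !inE; case: eqVneq => [->|]; rewrite ?jS ?addbF.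
Qed.

Lemma tog_notin j S : j \notin S -> tog j S = j |: S.
Proof.
by move=> jS; apply/setP=> x; rewrite !inE; case: eqVneq => [->|]; rewrite ?(negPf jS) ?addbF.
Qed.

Lemma tog_setC j S : ~: tog j S = tog j (~: S).
Proof. by apply/setP=> x; rewrite !inE addNb. Qed.

Lemma card_tog_in j S : j \in S -> #|S| = #|tog j S|.+1.
Proof. by move=> jS; rewrite tog_in // (cardsD1 j S) jS. Qed.

Lemma card_tog_notin j S : j \notin S -> #|tog j S| = #|S|.+1.
Proof. by move=> jS; rewrite tog_notin // cardsU1 jS. Qed.

Lemma odd_card_tog j S : odd #|tog j S| = ~~ odd #|S|.
Proof.
have [jS|jS] := boolP (j \in S); first by rewrite (card_tog_in jS) /= negbK.
by rewrite card_tog_notin.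
Qed.

Lemma tog_ind (K : {set T} -> Prop) :
  K set0 -> (forall j S, j \notin S -> K S -> K (tog j S)) -> forall S, K S.
Proof.
move=> K0 KS S; move: {2}#|S| (erefl #|S|) => m; elim: m S => [|m IH] S mS.
  by move/eqP: mS; rewrite cards_eq0 => /eqP ->.
have /card_gt0P[j jS] : (0 < #|S|)%N by rewrite mS.
rewrite -(togK j S); apply: KS; first by rewrite in_tog jS eqxx.
by apply: IH; apply: succn_inj; rewrite -mS (card_tog_in jS).
Qed.

Lemma odd_card_sd P Q : odd #|sd P Q| = odd #|P| (+) odd #|Q|.
Proof.
elim/tog_ind: P => [|j P _ IH].
  by rewrite cards0; congr (odd #|pred_of_set _|); apply/setP=> x; rewrite !inE.
by rewrite tog_sdl !odd_card_tog IH addNb.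
Qed.

End SymmetricDifference.

Section Signs.
Variables (F : fieldType) (T : finType) (rk : T -> nat).
Implicit Types (P Q S : {set T}) (i j : T).

(** The sign of moving [j] to the front of [S] listed by [rk]. As a product over the whole type it
    is multiplicative in [S] under symmetric difference. *)
Definition sg j S : F := \prod_i (-1) ^+ ((i \in S) && (rk i < rk j)%N).

Lemma sg_sd j P Q : sg j (sd P Q) = sg j P * sg j Q.
Proof.
rewrite /sg -big_split /=; apply: eq_bigr => i _.
by rewrite inE andb_addl signr_addb.
Qed.

Lemma sg_tog j l S : sg j (tog l S) = sg j S * (-1) ^+ (rk l < rk j)%N.
Proof.
have -> : tog l S = sd S [set l] by apply/setP=> x; rewrite !inE.
rewrite sg_sd; congr (_ * _); rewrite /sg (bigD1 l) //= set11 /=.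
by rewrite big1 ?mulr1 // => i /negPf il; rewrite inE il.
Qed.

Lemma sg_sqr j S : sg j S * sg j S = 1.
Proof.
by rewrite /sg -big_split big1 //= => i _; rewrite -signr_addb addbb.
Qed.

Lemma sg_neq0 j S : sg j S != 0.
Proof.
by apply/eqP=> h; have /eqP := sg_sqr j S; rewrite h mul0r eq_sym oner_eq0.
Qed.

Lemma sg_min j S : {in S, forall i, (rk j <= rk i)%N} -> sg j S = 1.
Proof.
move=> h; rewrite /sg big1 // => i _; have [iS|//] := boolP (i \in S).
by rewrite ltnNge h.
Qed.

Hypothesis rk_inj : injective rk.

Lemma sg_swap i j S : i != j ->
  sg i S * sg j (tog i S) = - (sg j S * sg i (tog j S)).
Proof.
move=> ij; rewrite !sg_tog.
have: rk i != rk j by apply: contra ij => /eqP/rk_inj ->.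
by case: ltngtP => //= _ _; rewrite expr0 expr1; ring.
Qed.

(** The terms cancel in pairs ordered by [rk]. The zero diagonal is a separate assumption because
    antisymmetry does not imply it in characteristic 2. *)
Lemma sum_antisym (t : T -> T -> F) :
  (forall i, t i i = 0) -> (forall i j, t i j = - t j i) ->
  \sum_i \sum_j t i j = 0.
Proof.
move=> t0 tA.
have E i j : t i j = (if (rk i < rk j)%N then t i j else 0)
                   + (if (rk j < rk i)%N then t i j else 0).
  case: ltngtP => [_|_|/rk_inj ->]; by rewrite ?addr0 ?add0r // t0.
under eq_bigr do (under eq_bigr do rewrite E; rewrite big_split /=).
rewrite big_split /= [X in _ + X]exchange_big /= -big_split /=.
apply: big1 => i _; rewrite -big_split /=; apply: big1 => j _.
by case: ifP => _; rewrite ?addr0 // (tA i j) addNr.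
Qed.

End Signs.

Lemma prod_sign_lt (F : fieldType) p j : (j <= p)%N ->
  \prod_(a < p) (-1) ^+ (a < j)%N = (-1) ^+ j :> F.
Proof.
move=> jp; rewrite -(big_mkord xpredT (fun a => (-1) ^+ (a < j)%N : F)).
rewrite (big_cat_nat (leq0n j) jp) //= [X in _ * X]big_nat [X in _ * X]big1 ?mulr1.
  rewrite big_nat (eq_bigr (fun=> -1)) => [|a /= ->//].
  by rewrite -big_nat prodr_const_nat subn0.
by move=> a /andP[ja _]; rewrite ltnNge ja.
Qed.

Section PfaffianFunction.
Variables (F : fieldType) (n : nat).
Implicit Types (M : 'M[F]_n) (S U : {set 'I_n}).

Definition pf M S : F := Pf (delete_mx M (~: S)).

Definition increasing m (h : 'I_m -> 'I_n) :=
  forall a b : 'I_m, (a < b)%N -> (h a < h b)%N.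

Lemma increasing_inj m (h : 'I_m -> 'I_n) : increasing h -> injective h.
Proof.
move=> hi a b hab; apply: val_inj; case: (ltngtP a b) => // /hi; by rewrite hab ltnn.
Qed.

Lemma increasing_lt m (h : 'I_m -> 'I_n) (a b : 'I_m) : increasing h ->
  (h a < h b)%N = (a < b)%N.
Proof.
move=> hi; case: (ltngtP a b) => [/hi //|/hi|/val_inj ->]; last by rewrite ltnn.
by move=> h1; apply/negbTE; rewrite -leqNgt ltnW.
Qed.

Lemma sorted_enum_ord (A : {set 'I_n}) :
  sorted (fun a b : 'I_n => (a < b)%N) (enum A).
Proof.
have -> : enum A = filter (mem A) (enum 'I_n) by rewrite {1}/enum_mem -enumT.
apply: sorted_filter; first by move=> a b c; apply: ltn_trans.
by have := iota_ltn_sorted 0 n; rewrite -val_enum_ord sorted_map.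
Qed.

Lemma enum_val_increasing (A : {set 'I_n}) :
  increasing (enum_val : 'I_#|A| -> 'I_n).
Proof.
move=> a b ab; have x0 := enum_val a.
rewrite !(enum_val_nth x0).
have tr : transitive (fun a b : 'I_n => (a < b)%N) by move=> ? ? ?; apply: ltn_trans.
have := sorted_ltn_nth tr x0 (sorted_enum_ord A).
by apply; rewrite ?inE -?cardE.
Qed.

Lemma enum_increasing m (h : 'I_m -> 'I_n) : increasing h ->
  enum (h @: setT) = [seq h i | i <- enum 'I_m].
Proof.
move=> hi.
apply: (@irr_sorted_eq _ (fun a b : 'I_n => (a < b)%N)) => [? ? ?|a|||x].
- exact: ltn_trans.
- exact: ltnn.
- exact: sorted_enum_ord.
- rewrite sorted_map.
  apply: (@sub_sorted _ (relpre val ltn)); first by move=> a b /= /hi.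
  by rewrite -sorted_map val_enum_ord iota_ltn_sorted.
rewrite mem_enum; apply/imsetP/mapP => -[y _ ->]; exists y => //; exact: mem_enum.
Qed.

Lemma Pf_increasing M m (h : 'I_m -> 'I_n) : increasing h ->
  Pf (\matrix_(a < m, b < m) M (h a) (h b)) = pf M (h @: setT).
Proof.
move=> hi; rewrite /pf /delete_mx setCK.
(* The sizes [m] and [#|h @: setT|] are equal only propositionally; a variable [m'] lets the
   equation be substituted. *)
have key m' (e : m' = m) (g : 'I_m' -> 'I_n) :
    (forall i, g i = h (cast_ord e i)) ->
    Pf (\matrix_(a < m, b < m) M (h a) (h b))
      = Pf (\matrix_(a < m', b < m') M (g a) (g b)).
  move=> gE; subst m'.
  by congr Pf; apply/matrixP=> a b; rewrite !mxE !gE !cast_ord_id.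
have e : #|h @: setT| = m.
  by rewrite card_imset ?cardsT ?card_ord //; apply: increasing_inj.
apply: (key _ e) => i; rewrite (enum_val_nth (h (cast_ord e i))).
have im : (i < m)%N := ltn_ord (cast_ord e i).
rewrite enum_increasing // (nth_map (cast_ord e i)) ?size_enum_ord //.
by congr h; apply: val_inj; rewrite /= nth_enum_ord.
Qed.

Lemma set_increasing U c : #|U| = c ->
  exists2 h : 'I_c -> 'I_n, increasing h & U = h @: setT.
Proof.
move=> <-; exists enum_val; first exact: enum_val_increasing.
apply/setP=> x; apply/idP/imsetP => [xU|[i _ ->]]; last exact: enum_valP.
by exists (enum_rank_in xU x) => //; rewrite enum_rankK_in.
Qed.

Lemma pf_odd M S : odd #|S| -> pf M S = 0.
Proof. by move=> h; rewrite /pf Pf_odd // setCK. Qed.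

Lemma pf0 M : pf M set0 = 1.
Proof.
rewrite /pf; move: (delete_mx _ _); have -> : #|~: ~: (set0 : {set 'I_n})| = 0%N.
  by rewrite setCK cards0.
exact: Pf0.
Qed.

Local Notation sgn := (sg F (@nat_of_ord n)).

(** [Pf_expand] carried along the increasing enumeration of [U]: the position of [l] is the number
    of smaller elements of [U :\ m], which turns [(-1) ^+ j] into [sgn l]. *)
Lemma pf_expand_min M U (m : 'I_n) : m \in U -> {in U, forall x : 'I_n, (m <= x)%N} ->
  pf M U = \sum_(l in U :\ m) sgn l (U :\ m) * M m l * pf M (U :\ m :\ l).
Proof.
move cU: #|U| => c; have [h] := set_increasing cU.
case: c cU h => [|[|p]] cU h hi UE mU mmin.
- have : (0 < #|U|)%N by apply/card_gt0P; exists m.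
  by rewrite cU.
- rewrite pf_odd ?cU // (_ : U :\ m = set0) ?big_set0 //.
  by apply/eqP; rewrite -cards_eq0 -eqSS -add1n; have := cardsD1 m U; rewrite mU cU => <-.
have mE : m = h ord0.
  apply: val_inj; apply/eqP; rewrite eqn_leq; apply/andP; split.
    by apply: mmin; rewrite UE imset_f.
  move: mU; rewrite UE => /imsetP[y _ ->].
  by rewrite leqNgt increasing_lt.
have hinj := increasing_inj hi.
have UmE : U :\ m = (h \o lift ord0) @: setT.
  apply/setP=> x; rewrite !inE UE mE; apply/andP/imsetP => [[xm /imsetP[y _ xE]]|[y _ ->]].
    move: xm; rewrite xE; case: (unliftP ord0 y) => [y'|] ->; rewrite ?eqxx // => _.
    by exists y'.
  by rewrite /= (inj_eq hinj) eq_sym neq_lift imset_f.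
rewrite {1}UE -Pf_increasing // Pf_expand UmE big_imset /=; last first.
  by move=> a b _ _ /hinj/lift_inj.
apply: eq_big => [j|j _]; first by rewrite inE.
rewrite mxE -mE; congr (_ * _ * _).
  rewrite /sg (bigID (mem (U :\ m))) /= [X in _ * X]big1 ?mulr1; last first.
    by move=> i; rewrite -UmE => /negPf ->.
  rewrite {1}UmE big_imset /=; last by move=> a b _ _ /hinj/lift_inj.
  rewrite (eq_bigl xpredT) => [|a]; last by rewrite inE.
  rewrite -(@prod_sign_lt F p.+1 j) 1?ltnW //; apply: eq_bigr => a _.
  by rewrite increasing_lt // imset_f //= lift0.
rewrite -[RHS](_ : pf M ((h \o lift ord0 \o lift j) @: setT) = _).
  rewrite -Pf_increasing; last first.
    move=> /= a b ab; rewrite increasing_lt //= /bump; lia.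
  by congr Pf; apply/matrixP=> a b; rewrite !mxE.
congr pf; rewrite -UmE; apply/setP=> x; rewrite in_setD1 UmE.
apply/imsetP/andP => [[y _ ->]|[xj /imsetP[y _ xE]]].
  split; last by apply/imsetP; exists (lift j y).
  by rewrite /= (inj_eq hinj) (inj_eq lift_inj) eq_sym neq_lift.
move: xj; rewrite xE /= (inj_eq hinj) (inj_eq lift_inj).
case: (unliftP j y) => [y'|] ->; rewrite ?eqxx // => _; by exists y'.
Qed.

End PfaffianFunction.

(** * Matchgate identities for Pfaffian minors *)

Section SkewMatrix.
Variables (F : fieldType) (n : nat) (M : 'M[F]_n).
Hypotheses (Mskew : forall i j, M i j = - M j i) (Mdiag : forall i, M i i = 0).
Implicit Types (P Q S : {set 'I_n}).
Local Notation sgn := (sg F (@nat_of_ord n)).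
Local Notation f := (pf M).

(* The expansion along row [a] of the Pfaffian of [a] followed by [S]. *)
Definition row_sum (a : 'I_n) S := \sum_(j in S) sgn j S * M a j * f (tog j S).

Lemma pf_row_min a S : a \notin S -> {in S, forall x : 'I_n, (a <= x)%N} ->
  row_sum a S = f (tog a S).
Proof.
move=> aS amin; rewrite (@pf_expand_min _ _ _ (tog a S) a); first last.
- by move=> x; rewrite in_tog; case: eqVneq => [->|_] //; rewrite addbF; apply: amin.
- by rewrite in_tog eqxx (negPf aS).
have -> : tog a S :\ a = S by rewrite -tog_in ?togK // in_tog eqxx (negPf aS).
by apply: eq_bigr => j jS; rewrite tog_in.
Qed.

(** Expansion along an arbitrary row: a repeated row gives 0, and otherwise moving [a] from the
    front to its place costs [sgn a S]. If [a] precedes [S] this is the first-row expansion;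
    otherwise the minors are expanded again along the least row [m]. *)
Lemma row_sumE S (a : 'I_n) :
  row_sum a S = if a \in S then 0 else sgn a S * f (tog a S).
Proof.
move: {2}#|S| (leqnn #|S|) => c; elim: c S a => [|c IH] S a.
  rewrite leqn0 cards_eq0 => /eqP ->; rewrite inE /row_sum big_set0.
  by rewrite pf_odd ?mulr0 // card_tog_notin ?inE // cards0.
case: (set_0Vmem S) => [-> _|[x0 x0S] cS].
  rewrite inE /row_sum big_set0.
  by rewrite pf_odd ?mulr0 // card_tog_notin ?inE // cards0.
case: (@arg_minnP _ x0 (mem S) (@nat_of_ord n) x0S) => m m_in mmin.
have {m_in} mS : m \in S by [].
have {}mmin x : x \in S -> (m <= x)%N by exact: mmin.
have [am|ma] := ltnP a m.
  have aS : a \notin S by apply/negP=> /mmin; rewrite /= leqNgt am.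
  have ax : {in S, forall x : 'I_n, (a <= x)%N}.
    by move=> x /mmin /=; apply: leq_trans; apply: ltnW.
  by rewrite (negPf aS) pf_row_min // sg_min // mul1r.
pose S' := tog m S.
have inS' x : (x \in S') = (x \in S) (+) (x == m) by rewrite in_tog.
have SE : S = tog m S' by rewrite togK.
have S'E : tog m S = S' by [].
clearbody S'.
have mS' : m \notin S' by rewrite inS' mS eqxx.
have S'in j : j \in S' -> j \in S /\ j != m.
  by rewrite inS'; case: eqVneq => [->|]; rewrite ?mS ?addbF.
have S'min : {in S', forall x : 'I_n, (m <= x)%N}.
  by move=> x /S'in[/mmin].
have cS' : (#|S'| <= c)%N by rewrite -S'E -ltnS -(card_tog_in mS).
have big_S (t : 'I_n -> F) : \sum_(j in S) t j = t m + \sum_(j in S') t j.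
  rewrite (bigD1 m) //=; congr (_ + _); apply: eq_bigl => j.
  by rewrite inS'; case: eqVneq => [->|]; rewrite ?mS ?addbF ?andbF ?andbT.
have sgS j : j \in S' -> sgn j S = - sgn j S'.
  move=> /[dup] /S'in[jS jm] /S'min mj.
  rewrite SE sg_tog (_ : (m < j)%N) ?mulrN1 //.
  by rewrite ltn_neqAle mj andbT eq_sym.
have fS j : j \in S' -> f (tog j S) = row_sum m (tog j S').
  move=> jS'; rewrite pf_row_min; first by rewrite [in RHS]togC -SE.
    by rewrite in_tog (negPf mS') /= eq_sym; case: (S'in _ jS').
  move=> x; rewrite in_tog; case: eqVneq => [->|_]; first by rewrite jS'.
  by rewrite addbF; apply: S'min.
(* The term [j = m] stands alone; in all others the minor is expanded along row [m]. *)
have E : row_sum a S = M a m * f S' - \sum_(j in S') \sum_(l in S' | l != j)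
     sgn j S' * sgn l (tog j S') * M a j * M m l * f (tog l (tog j S')).
  rewrite /row_sum big_S; congr (_ + _).
    rewrite S'E sg_min ?mul1r // => x xS; exact: mmin.
  rewrite -sumrN; apply: eq_bigr => j jS'; rewrite fS // sgS // mulNr mulNr.
  congr (- _); rewrite big_distrr /=; apply: eq_big => l.
    by rewrite in_tog; case: eqVneq => [->|]; rewrite ?jS' ?addbF ?andbT.
  by move=> _; ring.
have [aE|am] := eqVneq a m.
  rewrite E aE Mdiag mul0r add0r mS; apply/eqP; rewrite oppr_eq0; apply/eqP.
  (* For [a = m] the sum runs over ordered pairs of deleted elements; swapping them keeps the
     entries and flips the sign. *)
  pose t (j l : 'I_n) := if [&& j \in S', l \in S' & l != j] then
     sgn j S' * sgn l (tog j S') * M m j * M m l * f (tog l (tog j S')) else 0.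
  rewrite -[RHS](@sum_antisym F _ (@nat_of_ord n) (@ord_inj n) t).
  - rewrite big_mkcond; apply: eq_bigr => j _; rewrite /t.
    case: (j \in S') => /=; first by rewrite big_mkcond.
    by rewrite big1.
  - by move=> i; rewrite /t eqxx !andbF.
  move=> i j; rewrite /t (eq_sym i j); case: ifP => [/and3P[-> -> ji]|h].
    rewrite ji /= (sg_swap F (@ord_inj n)) 1?eq_sym // togC; ring.
  by rewrite andbCA h oppr0.
(* Exchanging the deletions of [j] and [l] flips the sign and regroups the sum into row expansions
   over the smaller sets [tog l S']. *)
have E2 : row_sum a S = M a m * f S'
     + \sum_(l in S') sgn l S' * M m l * row_sum a (tog l S').
  rewrite E; congr (_ + _).
  rewrite (exchange_big_dep (mem S')) /=; last by move=> j l _ /andP[].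
  rewrite -sumrN; apply: eq_bigr => l lS'.
  rewrite big_distrr -sumrN /=; apply: eq_big => j.
    rewrite in_tog /= [l == j]eq_sym.
    by case: eqVneq => [->|]; rewrite ?lS' ?addbF ?andbT.
  case/andP=> _ /andP[_ lj].
  by rewrite (sg_swap F (@ord_inj n)) 1?eq_sym // togC; ring.
have aS'E : (a \in S) = (a \in S') by rewrite inS' (negPf am) addbF.
rewrite E2; have [aS|aS] := boolP (a \in S).
  have aS' : a \in S' by rewrite -aS'E.
  (* By induction only [l = a] survives, and skewness cancels it against the term [M a m * f S']. *)
  rewrite (bigD1 a) //= big1 => [|l /andP[lS' la]]; last first.
    rewrite IH; last by rewrite -ltnS -card_tog_in // leqW.
    by rewrite in_tog aS' eq_sym (negPf la) mulr0.
  rewrite IH; last by rewrite -ltnS -card_tog_in // leqW.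
  rewrite in_tog aS' eqxx /= togK sg_tog ltnn mulr1 addr0.
  transitivity (M a m * f S' + sgn a S' * sgn a S' * M m a * f S'); first by ring.
  by rewrite sg_sqr (Mskew m a); ring.
(* Expanding the right-hand side along its least row [m] gives the same terms, the one at [l = a]
   matching [M a m * f S']. *)
rewrite (@pf_expand_min _ _ _ (tog a S) m); first last.
- move=> x; rewrite in_tog; case: eqVneq => [->|_] //; rewrite addbF; exact: mmin.
- by rewrite in_tog mS eq_sym (negPf am).
have -> : tog a S :\ m = tog a S'.
  by rewrite -tog_in ?in_tog ?mS 1?eq_sym ?(negPf am) // togC S'E.
have aS' : a \notin S' by rewrite -aS'E.
have aT : a \in tog a S' by rewrite in_tog eqxx (negPf aS').
have ma' : (m < a)%N by rewrite ltn_neqAle ma andbT eq_sym.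
have sgaS : sgn a S = - sgn a S'.
  by rewrite SE sg_tog ma' mulrN1.
rewrite [in RHS](bigD1 a) //= -tog_in // togK sg_tog ltnn mulr1 mulrDr; congr (_ + _).
  rewrite sgaS (Mskew m a); transitivity (sgn a S' * sgn a S' * M a m * f S'); last by ring.
  by rewrite sg_sqr mul1r.
rewrite big_distrr /=; apply: eq_big => l.
  by rewrite in_tog; case: eqVneq => [->|]; rewrite ?(negPf aS') ?addbF ?andbF ?andbT.
move=> lS'; have la : l != a by apply: contraNneq aS' => <-.
rewrite -tog_in; last by rewrite in_tog lS' (negPf la).
rewrite IH; last by rewrite -ltnS -card_tog_in // leqW.
rewrite in_tog (negPf aS') eq_sym (negPf la) /= togC sgaS.
have := @sg_swap F _ _ (@ord_inj n) l a S' la; set s1 := sgn a _; set s2 := sgn l (tog a S').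
rewrite -/s1 => h.
by transitivity (- (sgn l S' * s1) * (- M m l) * f (tog l (tog a S'))); [ring | rewrite h; ring].
Qed.

(** [u P Q] is a double sum with coefficients [M j l], so skewness gives [u P Q = - u Q P]. By
    [row_sumE] these two quantities are the parts of the sum with [j] in [P] and with [j] in [Q]. *)
Lemma pf_mgi P Q :
  \sum_(j in sd P Q) sgn j (sd P Q) * f (tog j P) * f (tog j Q) = 0.
Proof.
pose u (A B : {set 'I_n}) := \sum_(j in A) sgn j A * f (tog j A) * row_sum j B.
have uE A B : u A B = \sum_(j in sd A B | j \in A)
    sgn j (sd A B) * f (tog j A) * f (tog j B).
  rewrite /u (bigID (mem B)) /= big1 ?add0r => [|j /andP[_ jB]]; last first.
    by rewrite row_sumE jB mulr0.
  apply: eq_big => j; first by rewrite in_sd; do 2!case: (j \in _).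
  by move=> /andP[_ /negPf jB]; rewrite row_sumE jB sg_sd; ring.
transitivity (u P Q + u Q P); last first.
  apply/eqP; rewrite addr_eq0 -sumrN; apply/eqP.
  rewrite /u; under eq_bigr do rewrite big_distrr /=.
  rewrite exchange_big /=; apply: eq_bigr => l lQ.
  rewrite big_distrr /= -sumrN; apply: eq_bigr => j jP.
  by rewrite (Mskew l); ring.
rewrite (bigID (mem P)) /=; congr (_ + _); first by rewrite uE.
rewrite uE sdC; apply: eq_big => j; last by move=> _; ring.
by rewrite in_sd; do 2!case: (j \in _).
Qed.

End SkewMatrix.

(** Following a nonzero term through successive expansions builds a perfect matching of [S]. This is
    what guarantees that [mu] finds a matching. *)
Lemma pf_neq0_matching (F : fieldType) n (M : 'M[F]_n) (S : {set 'I_n}) :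
  pf M S != 0 ->
  exists2 E : {set 'I_n * 'I_n},
    (forall e, e \in E -> (e.1 < e.2)%N && (M e.1 e.2 != 0)) &
    forall v, #|[set e in E | (v == e.1) || (v == e.2)]| = (v \in S).
Proof.
move: {2}#|S| (leqnn #|S|) => c; elim: c S => [|c IH] S.
  rewrite leqn0 cards_eq0 => /eqP -> _; exists set0 => [e|v]; rewrite ?inE //.
  by apply/eqP; rewrite cards_eq0; apply/eqP/setP=> e; rewrite !inE.
case: (set_0Vmem S) => [-> _ _|[x0 x0S] cS].
  exists set0 => [e|v]; rewrite ?inE //.
  by apply/eqP; rewrite cards_eq0; apply/eqP/setP=> e; rewrite !inE.
case: (@arg_minnP _ x0 (mem S) (@nat_of_ord n) x0S) => m m_in mmin.
have {m_in} mS : m \in S by [].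
have {}mmin x : x \in S -> (m <= x)%N by exact: mmin.
rewrite (@pf_expand_min _ _ _ S m mS) // => nz.
have [l lS] : exists2 l, l \in S :\ m & M m l * pf M (S :\ m :\ l) != 0.
  apply/exists_inP; apply: contraNT nz; rewrite negb_exists => /forallP h.
  apply/eqP; apply: big1 => l lS; move: (h l); rewrite lS /= negbK => /eqP e.
  by rewrite -mulrA e mulr0.
rewrite mulf_eq0 negb_or => /andP[Ml fl].
have cl : (#|S :\ m :\ l| <= c)%N.
  move: cS; rewrite (cardsD1 m S) mS (cardsD1 l (S :\ m)) lS; lia.
have [E E1 E2] := IH _ cl fl.
move: lS; rewrite in_setD1 => /andP[lm lS].
have ml : (m < l)%N by rewrite ltn_neqAle mmin // andbT eq_sym.
have nin v : v \notin S :\ m :\ l -> forall e, e \in E -> (v != e.1) && (v != e.2).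
  move=> vS e eE; rewrite -negb_or; apply/negP=> h.
  have /eqP := E2 v; rewrite (negPf vS) cards_eq0 => /eqP/setP/(_ e).
  by rewrite !inE eE h.
exists ((m, l) |: E) => [e|v].
  by rewrite !inE => /orP[/eqP -> /=|/E1 //]; rewrite ml.
have mlE : (m, l) \notin E.
  by apply/negP=> /(nin m); rewrite !inE eqxx andbF => /(_ isT).
have [h|h] := boolP ((v == m) || (v == l)).
  have -> : [set e in (m, l) |: E | (v == e.1) || (v == e.2)] = [set (m, l)].
    apply/setP=> e; rewrite !inE; have [->|/=] := eqVneq e (m, l); first by rewrite h.
    move=> _; apply/negP=> /andP[eE].
    have /nin/(_ e eE) : v \notin S :\ m :\ l by rewrite !inE; case/orP: h => /eqP ->; rewrite eqxx ?andbF.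
    by rewrite -negb_or => /negP.
  by rewrite cards1; case/orP: h => /eqP ->; rewrite ?mS ?lS.
have -> : [set e in (m, l) |: E | (v == e.1) || (v == e.2)]
    = [set e in E | (v == e.1) || (v == e.2)].
  apply/setP=> e; rewrite !inE; have [->|//] := eqVneq e (m, l).
  by rewrite (negPf mlE) /= (negPf h).
by rewrite E2 !inE; move: h; rewrite negb_or => /andP[-> ->].
Qed.

(** * Summation over the omittable nodes *)

Definition par (F : fieldType) (T : finType) (S : {set T}) : F :=
  (-1) ^+ odd #|S|.

Lemma parE (F : fieldType) (T : finType) (S : {set T}) :
  par F S = \prod_i (-1) ^+ (i \in S).
Proof.
rewrite /par signr_odd -prodr_const [LHS]big_mkcond.
by apply: eq_bigr => i _; case: (i \in S).
Qed.

Lemma par_sqr (F : fieldType) (T : finType) (S : {set T}) : par F S * par F S = 1.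
Proof. by rewrite /par -signr_addb addbb. Qed.

Lemma par_sd (F : fieldType) (T : finType) (P Q : {set T}) :
  par F (sd P Q) = par F P * par F Q.
Proof. by rewrite /par odd_card_sd signr_addb. Qed.

Lemma sg_max (F : fieldType) (T : finType) (rk : T -> nat) j (S : {set T}) :
  {in S, forall i, (rk i < rk j)%N} -> sg F rk j S = par F S.
Proof.
move=> h; rewrite parE; apply: eq_bigr => i _.
by have [iS|//] := boolP (i \in S); rewrite h.
Qed.

(** Along [S] the signs are 1, -1, 1, and so on. This is the origin of the parity term in the
    identities. *)
Lemma sg_sum (F : fieldType) (T : finType) (rk : T -> nat) (S : {set T}) :
  injective rk -> \sum_(i in S) sg F rk i S = (odd #|S|)%:R.
Proof.
move=> rk_inj; move: {2}#|S| (leqnn #|S|) => c; elim: c S => [|c IH] S.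
  by rewrite leqn0 cards_eq0 => /eqP ->; rewrite big_set0 cards0.
case: (set_0Vmem S) => [-> _|[x0 x0S] cS]; first by rewrite big_set0 cards0.
case: (@arg_maxnP _ x0 (mem S) rk x0S) => m m_in mmax.
have {m_in} mS : m \in S by [].
have {}mmax x : x \in S -> (rk x <= rk m)%N by exact: mmax.
have mlt x : x \in S -> x != m -> (rk x < rk m)%N.
  move=> xS xm; rewrite ltn_neqAle mmax // andbT.
  by apply: contra xm => /eqP/rk_inj ->.
have cm := card_tog_in mS.
rewrite (bigD1 m) //=.
have sgm : sg F rk m S = par F (tog m S).
  rewrite -{1}(togK m S) sg_tog ltnn mulr1 sg_max // => i.
  by rewrite tog_in // in_setD1 => /andP[im iS]; apply: mlt.
have -> : \sum_(i in S | i != m) sg F rk i S = (odd #|tog m S|)%:R.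
  rewrite -IH; last by rewrite -ltnS -cm.
  apply: eq_big => i; first by rewrite tog_in // in_setD1 andbC.
  move=> /andP[iS im]; rewrite -{1}(togK m S) sg_tog.
  by rewrite ltnNge ltnW ?mulr1 // mlt.
by rewrite sgm cm /par /=; case: (odd _); rewrite ?expr0 ?expr1 ?addr0 ?addNr.
Qed.

Section Twisted.
Variables (F : fieldType) (n : nat) (X Y T : {set 'I_n}) (f : {set 'I_n} -> F).
Implicit Types (P Q S A B : {set 'I_n}).
Local Notation sgn := (sg F (@nat_of_ord n)).

Hypothesis X_lt : forall i j : 'I_n, i \in X -> j \notin X -> (i < j)%N.
Hypothesis Y_gt : forall i j : 'I_n, i \in Y -> j \notin Y -> (j < i)%N.
Hypothesis XY : [disjoint X & Y].
Hypothesis XT : [disjoint X & T].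
Hypothesis YT : [disjoint Y & T].
Hypothesis f_mgi : forall P Q,
  \sum_(j in sd P Q) sgn j (sd P Q) * f (tog j P) * f (tog j Q) = 0.
Variable b : bool.
Hypothesis f_parity : forall S, f S != 0 -> odd #|S| = b.

Definition omit_sum S := \sum_(A : {set 'I_n} | A \subset T) f (sd S A).
Local Notation g := omit_sum.

(** A nonzero product forces [sd P Q] to have even size, so [D] and [E] have the same parity. Term
    by term, this trades the parity of the omitted sets for that of [D]. *)
Lemma parity_mul (P Q D E : {set 'I_n}) (u v : F) :
  sd P Q = sd D E -> (odd #|D| = odd #|E| -> u = v) ->
  u * (f P * f Q) = v * (f P * f Q).
Proof.
move=> DE uv.
have [->|fP] := eqVneq (f P) 0; first by rewrite mul0r !mulr0.
have [->|fQ] := eqVneq (f Q) 0; first by rewrite !mulr0.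
congr (_ * _); apply: uv.
have : odd #|sd P Q| = false by rewrite odd_card_sd !f_parity // addbb.
by rewrite DE odd_card_sd; case: (odd _); case: (odd _).
Qed.

Lemma omit_sum_mul P Q j : g (tog j P) * g (tog j Q) =
  \sum_(A : {set 'I_n} | A \subset T) \sum_(B : {set 'I_n} | B \subset T)
     f (tog j (sd P A)) * f (tog j (sd Q B)).
Proof.
rewrite /omit_sum big_distrl /=; apply: eq_bigr => A _.
by rewrite big_distrr /=; apply: eq_bigr => B _; rewrite !tog_sdl.
Qed.

Lemma sum_sub_tog (t : {set 'I_n} -> F) i : i \in T ->
  \sum_(A : {set 'I_n} | A \subset T) t (tog i A)
    = \sum_(A : {set 'I_n} | A \subset T) t A.
Proof.
move=> iT; rewrite [RHS](reindex_inj (inv_inj (togK i))) /=.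
have sub A : A \subset T -> tog i A \subset T.
  move=> /subsetP AT; apply/subsetP=> x; rewrite in_tog.
  by case: eqVneq => [->//|_]; rewrite addbF; apply: AT.
by apply: eq_bigl => A; apply/idP/idP=> /sub //; rewrite togK.
Qed.

(* Signed sums over the sets A, B of omitted nodes telescope: toggling i in both A
   and B leaves sd A B unchanged, so the terms at omittable i add up to
   [sg_sum] times g P * g Q. *)
Lemma twisted_mgi P Q : P \subset X :|: Y -> Q \subset X :|: Y ->
  let D := sd P Q in
  \sum_(j in D | j \in X) sgn j D * (g (tog j P) * g (tog j Q))
  + par F D * (\sum_(j in D | j \in Y) sgn j D * (g (tog j P) * g (tog j Q)))
  + par F (D :&: X) * (odd #|D|)%:R * (g P * g Q) = 0.
Proof.
move=> /subsetP PXY /subsetP QXY D.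
have DXY j : j \in D -> (j \in X) || (j \in Y).
  rewrite in_sd => h; have : (j \in P) || (j \in Q) by move: h; do 2!case: (j \in _).
  by case/orP=> [/PXY|/QXY]; rewrite inE.
have sdE A B : sd (sd P A) (sd Q B) = sd D (sd A B).
  by apply/setP=> x; rewrite !inE addbACA.
clearbody D.
have XYn j : j \in X -> j \notin Y by move=> h; rewrite (disjointFr XY h).
have XTn j : j \in X -> j \notin T by move=> h; rewrite (disjointFr XT h).
have YTn j : j \in Y -> j \notin T by move=> h; rewrite (disjointFr YT h).
have DTn j : j \in D -> j \notin T by move=> /DXY/orP[/XTn|/YTn].
have sdT A B j : A \subset T -> B \subset T -> j \in sd A B -> j \in T.
  move=> /subsetP AT /subsetP BT; rewrite in_sd => h.
  have : (j \in A) || (j \in B) by move: h; do 2!case: (j \in _).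
  by case/orP=> [/AT|/BT].
pose t A B j := f (tog j (sd P A)) * f (tog j (sd Q B)).
(* The hypothesis on [f] is applied to [sd P A] and [sd Q B], and the sum split by the position of
   [j]. No element of [sd A B] precedes an input, all precede an output, and an omittable node is
   preceded, within [D], exactly by [D :&: X]. *)
have main A B : A \subset T -> B \subset T ->
    \sum_(j in D | j \in X) sgn j D * t A B j
    + par F D * (\sum_(j in D | j \in Y) sgn j D * t A B j)
    + par F (D :&: X) * (\sum_(j in sd A B) sgn j (sd A B) * t A B j) = 0.
  move=> AT BT; apply: etrans (f_mgi (sd P A) (sd Q B)); rewrite sdE.
  rewrite [RHS](bigID (mem D)) /= [X in _ = X + _](bigID (mem X)) /=.
  congr (_ + _ + _).
  - apply: eq_big => j.
      have [jD|_] := boolP (j \in D); last by rewrite andbF.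
      rewrite in_sd jD andbT; case jE: (j \in sd A B) => //.
      by have := sdT _ _ _ AT BT jE; rewrite (negPf (DTn _ jD)).
    move=> /andP[jD jX]; rewrite -mulrA /t; congr (_ * _).
    rewrite sg_sd [X in _ * X]sg_min ?mulr1 // => i /(sdT _ _ _ AT BT) iT.
    by apply/ltnW/X_lt => //; apply/negP=> /XTn; rewrite iT.
  - rewrite big_distrr /=; apply: eq_big => j.
      have [jD|_] := boolP (j \in D); last by rewrite andbF.
      rewrite in_sd jD andbT; case jE: (j \in sd A B) => /=.
        by have := sdT _ _ _ AT BT jE; rewrite (negPf (DTn _ jD)).
      by have := DXY _ jD; case: (boolP (j \in X)) => //= /XYn /negPf ->.
    move=> /andP[jD jY]; rewrite -mulrA -/(t A B j) mulrA.
    apply: (@parity_mul _ _ D (sd A B)) => [|e].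
      by rewrite sd_tog sdE.
    rewrite sg_sd mulrC; congr (_ * _); rewrite sg_max; first by rewrite /par e.
    move=> i /(sdT _ _ _ AT BT) iT; apply: Y_gt => //.
    by apply/negP=> /YTn; rewrite iT.
  rewrite big_distrr /=; apply: eq_big => j.
    rewrite [in RHS]in_sd; case jE: (j \in sd A B) => /=; last by rewrite addbF andbN.
    by have := sdT _ _ _ AT BT jE; case: (boolP (j \in D)) => // /DTn /negPf ->.
  move=> jE; have jT := sdT _ _ _ AT BT jE.
  rewrite -[RHS]mulrA -/(t A B j) [in RHS](sg_sd _ _ j D) mulrA; congr (_ * _ * _).
  rewrite parE; apply: eq_bigr => i _; rewrite in_setI; congr (_ ^+ nat_of_bool _).
  have [iD|//] := boolP (i \in D); rewrite /=.
  have jX : j \notin X by apply/negP=> /XTn; rewrite jT.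
  have jY : j \notin Y by apply/negP=> /YTn; rewrite jT.
  have [iX|iX] := boolP (i \in X); first by rewrite X_lt.
  have iY : i \in Y by have := DXY _ iD; rewrite (negPf iX).
  by rewrite ltnNge ltnW // Y_gt.
have total : \sum_(A : {set 'I_n} | A \subset T) \sum_(B : {set 'I_n} | B \subset T)
    (\sum_(j in D | j \in X) sgn j D * t A B j
    + par F D * (\sum_(j in D | j \in Y) sgn j D * t A B j)
    + par F (D :&: X) * (\sum_(j in sd A B) sgn j (sd A B) * t A B j)) = 0.
  by apply: big1 => A AT; apply: big1 => B BT; apply: main.
have sumX (W : {set 'I_n}) : \sum_(j in D | j \in W) sgn j D * (g (tog j P) * g (tog j Q)) =
   \sum_(A : {set 'I_n} | A \subset T) \sum_(B : {set 'I_n} | B \subset T)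
    \sum_(j in D | j \in W) sgn j D * t A B j.
  under [RHS]eq_bigr do rewrite exchange_big /=.
  rewrite [RHS]exchange_big /=; apply: eq_bigr => j _.
  rewrite omit_sum_mul big_distrr /=; apply: eq_bigr => A _.
  by rewrite big_distrr.
apply: etrans total; rewrite !sumX.
under [RHS]eq_bigr do rewrite !big_split /= -!big_distrr /=.
rewrite !big_split /= -!big_distrr /=; congr (_ + _ + _).
rewrite -mulrA; congr (_ * _).
pose u A B j := if j \in sd A B then sgn j (sd A B) else 0.
have uE A B (v : 'I_n -> F) : A \subset T -> B \subset T ->
    \sum_(j in sd A B) sgn j (sd A B) * v j = \sum_(j in T) u A B j * v j.
  move=> AT BT; rewrite [LHS]big_mkcond [RHS]big_mkcond /=.
  apply: eq_bigr => j _; rewrite /u; case jE: (j \in sd A B).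
    by rewrite (sdT _ _ _ AT BT jE).
  by rewrite mul0r if_same.
(* For nonzero products the parities of [D] and [sd A B] agree, and [sg_sum] spreads the latter over
   the omittable nodes. *)
transitivity (\sum_(A : {set 'I_n} | A \subset T) \sum_(B : {set 'I_n} | B \subset T)
    \sum_(j in T) u A B j * (f (sd P A) * f (sd Q B))).
  rewrite /omit_sum [in LHS]big_distrl /= big_distrr /=; apply: eq_bigr => A AT.
  rewrite !big_distrr /=; apply: eq_bigr => B BT.
  rewrite -uE // -big_distrl /= sg_sum; last exact: ord_inj.
  by apply: (@parity_mul _ _ D (sd A B)) => [|->//]; rewrite sdE.
transitivity (\sum_(A : {set 'I_n} | A \subset T) \sum_(B : {set 'I_n} | B \subset T)
    \sum_(j in T) u A B j * t A B j); last first.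
  by apply: eq_bigr => A AT; apply: eq_bigr => B BT; rewrite uE.
under eq_bigr do rewrite exchange_big /=.
rewrite exchange_big /=.
under [RHS]eq_bigr do rewrite exchange_big /=.
rewrite [RHS]exchange_big /=; apply: eq_bigr => j jT.
rewrite -[LHS](sum_sub_tog _ jT); apply: eq_bigr => A AT.
rewrite -[LHS](sum_sub_tog _ jT); apply: eq_bigr => B BT.
by rewrite /u sd_tog /t !tog_sdr.
Qed.

End Twisted.

(** * Matchgate identities for characters *)

Lemma pf_setC (F : fieldType) n (M : 'M[F]_n) (A : {set 'I_n}) :
  pf M (~: A) = Pf (delete_mx M A).
Proof. by rewrite /pf (setCK A). Qed.

Section ExternalSign.
Variables (F : fieldType) (n : nat) (X Y : {set 'I_n}).
Implicit Types (P Q Z D : {set 'I_n}) (i j z : 'I_n).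

(** For an external node [z]: [j] lies inside the span of the external edge of [z]. *)
Definition outer j z := if z \in X then (j < z)%N else (z < j)%N.

(** A candidate for [mu] that mentions no matching. *)
Definition ext_sign Z : F :=
  \prod_z \prod_j (-1) ^+ [&& z \in Z, j \notin Z & outer j z].

Lemma ext_sign_tog i Z : ext_sign (tog i Z) = ext_sign Z *
  (\prod_j (-1) ^+ ((j \notin Z) && outer j i) *
   \prod_z (-1) ^+ ((z \in Z) && outer i z)).
Proof.
have one (t : 'I_n -> F) : \prod_z (if z == i then t z else 1) = t i.
  by rewrite -big_mkcond big_pred1_eq.
(* Only pairs with [z = i] or [j = i] change; modulo 2 gaining and losing a pair count alike, and
   [outer i i] is false. *)
have E z j : (-1) ^+ [&& z \in tog i Z, j \notin tog i Z & outer j z] =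
   (-1) ^+ [&& z \in Z, j \notin Z & outer j z] *
   ((if z == i then (-1) ^+ ((j \notin Z) && outer j z) else 1) *
    (if j == i then (-1) ^+ ((z \in Z) && outer j z) else 1)) :> F.
  have oi : outer i i = false by rewrite /outer ltnn if_same.
  rewrite !in_tog; have [->|zi] := eqVneq z i.
    have [->|ji] := eqVneq j i.
      by case: (i \in Z); rewrite /= oi ?expr0 ?mulr1.
    case: (i \in Z); case: (j \in Z); case: (outer j i);
      by rewrite /= ?expr0 ?expr1 ?mulr1 ?mul1r ?mulrNN ?mulr1.
  have [->|ji] := eqVneq j i.
    case: (i \in Z); case: (z \in Z); case: (outer i z);
      by rewrite /= ?expr0 ?expr1 ?mulr1 ?mul1r ?mulrNN ?mulr1.
  by rewrite !addbF !mulr1.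
rewrite /ext_sign (eq_bigr _ (fun z _ => eq_bigr _ (fun j _ => E z j))) /=.
under eq_bigr do rewrite big_split /=.
rewrite big_split /=; congr (_ * _).
under eq_bigr do rewrite big_split /=.
rewrite big_split /=; congr (_ * _); last first.
  by apply: eq_bigr => z _; rewrite one.
by rewrite exchange_big /=; apply: eq_bigr => j _; rewrite one.
Qed.

Hypothesis X_lt : forall i j, i \in X -> j \notin X -> (i < j)%N.
Hypothesis XY : [disjoint X & Y].

(** Nodes outside [sd P Q] contribute twice and cancel. A node of it on the other side from [i]
    contributes equally in both directions; of two distinct nodes on the same side exactly one is
    outer. The minus sign accounts for [i] itself. *)
Lemma ext_sign_mul i P Q : sd P Q \subset X :|: Y -> i \in sd P Q ->
  ext_sign (tog i P) * ext_sign (tog i Q) = ext_sign P * ext_sign Q *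
    - par F (sd P Q :&: (if i \in X then X else Y)).
Proof.
move=> /subsetP DXY iD; rewrite !ext_sign_tog mulrACA; congr (_ * _).
rewrite mulrACA -!big_split /=.
set W := if _ then _ else _.
have iDW : i \in sd P Q :&: W.
  rewrite in_setI iD /W; case: ifP => // iX.
  by have := DXY i iD; rewrite inE iX.
have -> : - par F (sd P Q :&: W) = par F (tog i (sd P Q :&: W)).
  by rewrite /par odd_card_tog; case: (odd _); rewrite /= ?expr0 ?expr1 ?opprK.
rewrite parE; apply: eq_bigr => z _.
rewrite -!signr_addb; congr (_ ^+ nat_of_bool _).
transitivity ((z \in sd P Q) && (outer z i (+) outer i z)).
  rewrite in_sd; move: (outer z i) (outer i z) (z \in P) (z \in Q).
  by do 4!case.
rewrite tog_in // in_setD1 in_setI.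
have [zD|_] := boolP (z \in sd P Q); last by rewrite andbF.
rewrite /= /outer /W.
have [->|zi] := eqVneq z i; first by rewrite addbb.
have {}zi : z != i :> nat by [].
have [iX|iX] := boolP (i \in X); have [zX|zX] := boolP (z \in X) => //=.
- by move: zi; case: ltngtP.
- by rewrite addbb.
- by have := X_lt zX iX; case: ltngtP; rewrite // (disjointFr XY zX).
have := DXY z zD; rewrite inE (negPf zX) /= => ->.
by move: zi; case: ltngtP.
Qed.

End ExternalSign.

Section Character.
Variables (F : fieldType) (k : nat) (Gamma : matchgate F).
Local Notation n := (size_V Gamma).
Local Notation X := (inputs Gamma).
Local Notation Y := (outputs Gamma).
Local Notation T := (omittable Gamma).
Local Notation G := (graph Gamma).
Implicit Types (P Q Z : {set 'I_n}).
Local Notation sgn := (sg F (@nat_of_ord n)).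

Hypothesis kG : kbit k Gamma.

Lemma inputs_lt (i j : 'I_n) : i \in X -> j \notin X -> (i < j)%N.
Proof. by case: kG => _ _ -> _; rewrite !inE; lia. Qed.

Lemma outputs_gt (i j : 'I_n) : i \in Y -> j \notin Y -> (j < i)%N.
Proof. by case: kG => _ _ _ ->; rewrite !inE; lia. Qed.

Lemma skew_adj_skew i j : skew_adj G i j = - skew_adj G j i.
Proof. by rewrite !mxE; case: ltngtP; rewrite ?oppr0 ?opprK // weight_sym. Qed.

Lemma skew_adj_diag i : skew_adj G i i = 0.
Proof. by rewrite mxE ltnn. Qed.

Lemma skew_adj_neq0_edge i j : skew_adj G i j != 0 -> edge G i j.
Proof.
rewrite mxE; apply: contraNT => /weight_absent ->.
by rewrite oppr0 !if_same.
Qed.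

Lemma notin_omittable (j : 'I_n) : (j \in X) || (j \in Y) -> j \notin T.
Proof.
by case/orP=> h; [rewrite (disjointFr (disj_in_omit Gamma) h)
                 |rewrite (disjointFr (disj_out_omit Gamma) h)].
Qed.

(** The outer endpoint of an external edge lies beyond all of V, so an overlap means having exactly
    one end inside the span. *)
Lemma overlapE (e : 'I_n * 'I_n) (z : 'I_n) : (e.1 < e.2)%N -> z != e.1 -> z != e.2 ->
  overlap (internal_edge e) (external_edge z) = outer X e.1 z (+) outer X e.2 z.
Proof.
move=> e12 z1 z2; rewrite /overlap /internal_edge /external_edge /outer.
have {}z1 : z != e.1 :> nat by [].
have {}z2 : z != e.2 :> nat by [].
have := ltn_ord e.1; have := ltn_ord e.2; have := ltn_ord z.
by case: ifP => _ /=; lia.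
Qed.

Lemma outer_ext (j z : 'I_n) : (z \in X) || (z \in Y) -> outer X j z ->
  (j \in X) || (j \in Y).
Proof.
rewrite /outer; have [zX _ jz|zX zY jz] := boolP (z \in X).
  by apply/orP; left; apply: contraLR jz => /(inputs_lt zX); rewrite -leqNgt; apply: ltnW.
by apply/orP; right; apply: contraLR jz => /(outputs_gt zY); rewrite -leqNgt; apply: ltnW.
Qed.

(** Modulo 2, overlaps are counted by endpoints inside spans. A node inside a span is an input or an
    output, hence not omittable, hence covered exactly once if outside [Z] and never if in [Z]. *)
Lemma overlaps_sign Z E : Z \subset X :|: Y -> is_matching G T Z E ->
  (-1) ^+ overlaps Z E = ext_sign F X Z.
Proof.
move=> /subsetP ZXY /and3P[/forall_inP Eok /forallP Ele /forallP Ege].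
rewrite /overlaps exchange_big /= /ext_sign.
have signD (I : finType) (S : {set I}) (t : I -> nat) :
    (-1) ^+ (\sum_(i in S) t i) = \prod_(i in S) (-1) ^+ t i :> F.
  by rewrite (big_morph _ (exprD (-1)) (expr0 _)).
rewrite signD big_mkcond /=; apply: eq_bigr => z _.
have [zZ|zZ] := boolP (z \in Z); last by rewrite big1.
rewrite signD /=.
transitivity (\prod_(e in E) \prod_j ((-1) ^+ (((j == e.1) || (j == e.2)) && outer X j z)) : F).
  apply: eq_bigr => e eE; have /and4P[e12 _ e1 e2] := Eok _ eE.
  rewrite overlapE //; first last.
  - by apply: contraNneq e2 => <-.
  - by apply: contraNneq e1 => <-.
  have ne : e.2 != e.1 by apply: contraTneq e12 => ->; rewrite ltnn.
  rewrite (bigD1 e.1) //= (bigD1 e.2) //= big1; last first.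
    by move=> j /andP[/negPf -> /negPf ->].
  by rewrite eqxx eqxx orbT mulr1 /= signr_addb.
rewrite exchange_big /=; apply: eq_bigr => j _.
have [jz|_] := boolP (outer X j z); last by rewrite andbF big1 // => e _; rewrite andbF.
rewrite andbT.
have -> : \prod_(e in E) (-1) ^+ (((j == e.1) || (j == e.2)) && true)
    = (-1) ^+ #|[set e in E | (j == e.1) || (j == e.2)]| :> F.
  rewrite -prodr_const big_mkcond [RHS]big_mkcond /=; apply: eq_bigr => e _.
  by rewrite inE andbT; case: (e \in E) => //=; case: (_ || _).
have jXY := outer_ext _ jz.
have jT : j \notin T.
  by apply/notin_omittable/jXY; have := ZXY z zZ; rewrite inE.
have [jZ|jZ] := boolP (j \in Z) => /=.
  rewrite (_ : [set e in E | _] = set0) ?cards0 //.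
  apply/setP=> e; rewrite !inE; apply/negP=> /andP[/Eok/and4P[_ _ e1 e2]].
  by case/orP=> /eqP je; [move: e1 | move: e2]; rewrite -je jZ.
have jZT : j \notin Z :|: T by rewrite inE negb_or jZ.
have := Ege j; rewrite jZT /= => /exists_inP[e eE je].
have -> // : #|[set e in E | (j == e.1) || (j == e.2)]| = 1%N.
apply/eqP; rewrite eqn_leq Ele; apply/card_gt0P; exists e.
by rewrite inE eE.
Qed.

(** If [PfS] is nonzero, one of its Pfaffians is, and the matching it yields rules out the default
    branch of [mu]. *)
Lemma character_ext_sign Z : Z \subset X :|: Y ->
  character Z = ext_sign F X Z * PfS G T Z.
Proof.
move=> ZXY; rewrite /character; have [->|nz] := eqVneq (PfS G T Z) 0.
  by rewrite !mulr0.
congr (_ * _); rewrite /mu; case: pickP => [E EM|none]; first exact: overlaps_sign.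
have [A AT nzA] : exists2 A : {set 'I_n}, A \subset T & pf (skew_adj G) (~: (Z :|: A)) != 0.
  case: (pickP (fun A : {set 'I_n} => (A \subset T) && (pf (skew_adj G) (~: (Z :|: A)) != 0))).
    by move=> A /andP[]; exists A.
  move=> h; case/negP: nz; apply/eqP; apply: big1 => A AT.
  by move: (h A); rewrite AT /= pf_setC => /negbFE/eqP.
have [E E1 E2] := pf_neq0_matching nzA.
have nin e v : e \in E -> (v == e.1) || (v == e.2) -> v \notin Z :|: A.
  move=> eE h; have := E2 v; rewrite in_setC; case: (v \notin _) => //.
  by move/eqP; rewrite cards_eq0 => /eqP/setP/(_ e); rewrite !inE eE h.
have := none E; rewrite /is_matching => /negP[]; apply/and3P; split.
- apply/forall_inP=> e eE; have /andP[-> /skew_adj_neq0_edge ->] := E1 e eE.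
  have := nin e e.1 eE; rewrite eqxx => /(_ isT).
  have := nin e e.2 eE; rewrite eqxx orbT => /(_ isT).
  by rewrite !inE !negb_or => /andP[-> _] /andP[-> _].
- by apply/forallP=> v; rewrite E2 leq_b1.
apply/forallP=> v; apply/implyP=> vZT; apply/exists_inP.
have : #|[set e in E | (v == e.1) || (v == e.2)]| = 1%N.
  rewrite E2 in_setC (_ : v \notin Z :|: A) //.
  apply: contra vZT; rewrite !inE; case: (v \in Z) => //=; exact: (subsetP AT).
move=> c1; have /card_gt0P[e] : (0 < #|[set e in E | (v == e.1) || (v == e.2)]|)%N by rewrite c1.
by rewrite inE => /andP[eE h]; exists e.
Qed.

Lemma PfS_omit_sum Z : Z \subset X :|: Y ->
  PfS G T Z = omit_sum T (fun S => pf (skew_adj G) (~: S)) Z.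
Proof.
move=> /subsetP ZXY; apply: eq_bigr => A /subsetP AT; rewrite pf_setC.
congr (Pf (delete_mx _ _)); apply/setP=> x; rewrite !inE.
have [xZ|//] := boolP (x \in Z); have [/AT xA|//] := boolP (x \in A).
by have := ZXY x xZ; rewrite inE => /notin_omittable; rewrite xA.
Qed.

(** By [ext_sign_mul] the terms at inputs and at outputs acquire [- par F (D :&: X)] and
    [- par F (D :&: Y)]. As [par F D] is the product of the two parities, this is [twisted_mgi]
    multiplied by a sign. *)
Lemma character_mgi P Q : P \subset X :|: Y -> Q \subset X :|: Y ->
  \sum_(j in sd P Q) sgn j (sd P Q) * character (tog j P) * character (tog j Q)
    = (odd #|sd P Q|)%:R * character P * character Q.
Proof.
move=> PXY QXY.
have DXY : sd P Q \subset X :|: Y.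
  apply/subsetP=> x; rewrite in_sd => h.
  have : (x \in P) || (x \in Q) by move: h; do 2!case: (x \in _).
  by case/orP; [move/(subsetP PXY) | move/(subsetP QXY)].
have togXY j (S : {set 'I_n}) : j \in sd P Q -> S \subset X :|: Y -> tog j S \subset X :|: Y.
  move=> /(subsetP DXY) jXY /subsetP SXY; apply/subsetP=> x; rewrite in_tog.
  by case: eqVneq => [->//|_]; rewrite addbF; apply: SXY.
pose f S := pf (skew_adj G) (~: S).
have fm A B : \sum_(j in sd A B) sgn j (sd A B) * f (tog j A) * f (tog j B) = 0.
  have -> : sd A B = sd (~: A) (~: B).
    by apply/setP=> x; rewrite !inE; do 2!case: (x \in _).
  rewrite -[RHS](pf_mgi skew_adj_skew skew_adj_diag (~: A) (~: B)).
  by apply: eq_bigr => j _; rewrite /f !tog_setC.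
have fpar S : f S != 0 -> odd #|S| = odd n.
  rewrite /f => nz; have -> : odd n = odd #|S| (+) odd #|~: S|.
    by rewrite -oddD cardsC card_ord.
  by case o : (odd #|~: S|); rewrite ?addbF //; move: nz; rewrite pf_odd // eqxx.
have := twisted_mgi inputs_lt outputs_gt (disj_in_out Gamma) (disj_in_omit Gamma)
  (disj_out_omit Gamma) fm fpar PXY QXY.
set g := omit_sum _ _ => /= main.
have chiE (S : {set 'I_n}) : S \subset X :|: Y -> character S = ext_sign F X S * g S.
  by move=> h; rewrite character_ext_sign // PfS_omit_sum.
set th := ext_sign F X in chiE; pose D := sd P Q.
have YE j : j \in D -> (j \notin X) = (j \in Y).
  move=> /(subsetP DXY); rewrite inE; have [jX _|//] := boolP (j \in X).
  by rewrite (disjointFr (disj_in_out Gamma) jX).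
have DXDY : par F D = par F (D :&: X) * par F (D :&: Y).
  rewrite -par_sd; congr par; apply/setP=> x; rewrite in_sd !in_setI.
  by case xD : (x \in D); rewrite //= -YE //; case: (x \in X).
have EX : \sum_(j in D | j \in X) sgn j D * character (tog j P) * character (tog j Q)
   = th P * th Q * - par F (D :&: X) *
     \sum_(j in D | j \in X) sgn j D * (g (tog j P) * g (tog j Q)).
  rewrite big_distrr /=; apply: eq_bigr => j /andP[jD jX].
  rewrite !chiE ?togXY //.
  have := ext_sign_mul F inputs_lt (disj_in_out Gamma) DXY jD.
  rewrite jX -/th -/D => <-; ring.
have EY : \sum_(j in D | j \notin X) sgn j D * character (tog j P) * character (tog j Q)
   = th P * th Q * - par F (D :&: Y) *
     \sum_(j in D | j \in Y) sgn j D * (g (tog j P) * g (tog j Q)).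
  rewrite big_distrr /=; apply: eq_big => [j|j /andP[jD jX]].
    by case jD : (j \in D); rewrite //= YE.
  rewrite !chiE ?togXY //.
  have := ext_sign_mul F inputs_lt (disj_in_out Gamma) DXY jD.
  rewrite (negPf jX) -/th -/D => <-; ring.
rewrite (bigID (mem X)) /= -/D EX EY !chiE // -/th.
move: main; rewrite -/D; set a := \sum_(j in D | _) _; set b := \sum_(j in D | _) _ => main.
have pX := par_sqr F (D :&: X).
apply/eqP; rewrite -subr_eq0; apply/eqP.
transitivity (- (th P * th Q) * par F (D :&: X) *
   (a + (par F (D :&: X) * par F (D :&: X)) * (par F (D :&: Y) * par F (D :&: X)) * b + par F (D :&: X) * (odd #|D|)%:R * (g P * g Q))); last first.
  by rewrite pX mul1r [par F (D :&: Y) * _]mulrC -DXDY main mulr0.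
transitivity (th P * th Q * - par F (D :&: X) * a +
  th P * th Q * - par F (D :&: Y) * (par F (D :&: X) * par F (D :&: X)) * b -
  (par F (D :&: X) * par F (D :&: X)) * (odd #|D|)%:R * (th P * g P) * (th Q * g Q)).
  by rewrite pX mulr1 mul1r.
rewrite pX; ring: pX.
Qed.

End Character.

(** * The identities as a commutation relation *)

Definition mgi (F : fieldType) (I : finType) (rk : I -> nat) (g : {set I} -> F) :=
  forall P Q, \sum_(j in sd P Q) sg F rk j (sd P Q) * g (tog j P) * g (tog j Q)
    = (odd #|sd P Q|)%:R * g P * g Q.

(** The identity for [tog j S0] and [tog j S], with [j] in [sd S0 S], can be solved for [g S]: its
    term at [j] is a sign times [g S0 * g S], and all other arguments are within distance 2 of [S0]
    or closer to it than [S]. *)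
Lemma mgi_unique (F : fieldType) (I : finType) (rk : I -> nat) (g h : {set I} -> F) S0 :
  mgi rk g -> mgi rk h -> g S0 != 0 ->
  (forall S, (#|sd S0 S| <= 2)%N -> g S = h S) -> g =1 h.
Proof.
move=> mg mh g0 near S.
move: {2}#|sd S0 S| (leqnn #|sd S0 S|) => c; elim/ltn_ind: c S => c IH S cS.
have [/near //|c2] := leqP #|sd S0 S| 2.
have /card_gt0P[j jD] : (0 < #|sd S0 S|)%N by apply: leq_trans c2.
have closer T : (#|sd S0 T| < #|sd S0 S|)%N -> g T = h T.
  by move=> lt; apply: (IH #|sd S0 T|) => //; apply: leq_trans cS.
have := mg (tog j S0) (tog j S); have := mh (tog j S0) (tog j S).
rewrite sd_tog (bigD1 j) //= !togK => eh; rewrite (bigD1 j) //= !togK => eg.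
have nj : #|sd S0 (tog j S0)| = 1%N.
  by rewrite (_ : sd _ _ = [set j]) ?cards1 //; apply/setP=> x; rewrite !inE addbA addbb.
have sj : #|sd S0 S| = #|sd S0 (tog j S)|.+1 by rewrite tog_sdr -card_tog_in.
have gj0 : g (tog j S0) = h (tog j S0) by apply: near; rewrite nj.
have gjS : g (tog j S) = h (tog j S) by apply: closer; rewrite sj.
have rest : \sum_(i in sd S0 S | i != j) sg F rk i (sd S0 S) * g (tog i (tog j S0)) * g (tog i (tog j S))
   = \sum_(i in sd S0 S | i != j) sg F rk i (sd S0 S) * h (tog i (tog j S0)) * h (tog i (tog j S)).
  apply: eq_bigr => i /andP[iD ij].
  have iS : i \in sd S0 (tog j S) by rewrite tog_sdr in_tog iD (negPf ij).
  have c' : #|sd S0 (tog j S)| = #|sd S0 (tog i (tog j S))|.+1.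
    by rewrite (tog_sdr i) -card_tog_in.
  rewrite (closer (tog i (tog j S))); last by rewrite sj c' ltnW.
  rewrite near // tog_sdr.
  by rewrite card_tog_notin ?nj // tog_sdr in_tog (negPf ij) addbF in_sd addbb.
have g0h : g S0 = h S0.
  by apply: near; rewrite (_ : sd _ _ = set0) ?cards0 //; apply/setP=> x; rewrite !inE addbb.
move: eh; rewrite -rest -gj0 -gjS -eg => /addIr.
rewrite -!mulrA => /(mulfI (sg_neq0 F rk j (sd S0 S))).
by rewrite -g0h => /(mulfI g0) ->.
Qed.

(** Carries the identities from external nodes to abstract ports: an order-preserving injection
    preserves every sign. *)
Lemma mgi_transport (F : fieldType) (I J : finType) (rk : I -> nat) (rk' : J -> nat)
    (f : I -> J) (g : {set J} -> F) (E : {set J}) :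
  injective f -> (forall i j, (rk i < rk j)%N = (rk' (f i) < rk' (f j))%N) ->
  (forall i, f i \in E) ->
  (forall P Q : {set J}, P \subset E -> Q \subset E ->
    \sum_(j in sd P Q) sg F rk' j (sd P Q) * g (tog j P) * g (tog j Q)
      = (odd #|sd P Q|)%:R * g P * g Q) ->
  mgi rk (fun S => g (f @: S)).
Proof.
move=> fi mono fE mg P Q.
have sub (S : {set I}) : f @: S \subset E by apply/subsetP=> _ /imsetP[x _ ->].
have memf i (S : {set I}) : (f i \in f @: S) = (i \in S) by rewrite (mem_imset _ _ fi).
have imE (A : {set I}) (B : {set J}) : (forall i, (f i \in B) = (i \in A)) ->
    (forall x, x \in B -> exists i, x = f i) -> B = f @: A.
  move=> h1 h2; apply/setP=> x; apply/idP/imsetP => [xB|[i iA ->]]; last by rewrite h1.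
  by have [i xi] := h2 _ xB; exists i => //; rewrite -h1 -xi.
have sdf : sd (f @: P) (f @: Q) = f @: sd P Q.
  apply: imE => [i|x]; first by rewrite !in_sd !memf.
  rewrite in_sd => h; have : (x \in f @: P) || (x \in f @: Q).
    by move: h; do 2!case: (x \in _).
  by case/orP=> /imsetP[i _ ->]; exists i.
have togf j (S : {set I}) : tog (f j) (f @: S) = f @: tog j S.
  apply: imE => [i|x]; first by rewrite !in_tog memf (inj_eq fi).
  rewrite in_tog; case: eqVneq => [-> _|_]; first by exists j.
  by rewrite addbF => /imsetP[i _ ->]; exists i.
have := mg _ _ (sub P) (sub Q); rewrite sdf card_imset // => <-.
rewrite big_imset /=; last by move=> ? ? _ _; apply: fi.
apply: eq_bigr => j _; rewrite !togf; congr (_ * _ * _).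
rewrite /sg [RHS](bigID (mem (f @: setT))) /= [X in _ = _ * X]big1 ?mulr1.
  rewrite big_imset /=; last by move=> ? ? _ _; apply: fi.
  by apply: eq_big => [i|i _]; [rewrite inE | rewrite memf mono].
move=> x xn; case: (boolP (x \in f @: sd P Q)) => [/imsetP[i _ xi]|//].
by rewrite xi imset_f in xn.
Qed.

(** * Matrix indices as subsets *)

Lemma eq_bits k a b : (a < 2 ^ k)%N -> (b < 2 ^ k)%N ->
  (forall t, (t < k)%N -> odd (a %/ 2 ^ t) = odd (b %/ 2 ^ t)) -> a = b.
Proof.
elim: k a b => [|k IH] a b; first by rewrite expn0; case: a; case: b.
rewrite expnS => ak bk h.
have hd : odd a = odd b by have := h 0%N isT; rewrite expn0 !divn1.
have hh : a./2 = b./2.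
  apply: IH => [||t tk]; [lia | lia |].
  by have := h t.+1 tk; rewrite expnS !divnMA !divn2.
by rewrite -(odd_double_half a) -(odd_double_half b) hd hh.
Qed.

Section Bits.
Variable k : nat.

Definition bits (r : 'I_(2 ^ k)) : {set 'I_k} := [set t : 'I_k | bdigit k r t].

Lemma bits_inj : injective bits.
Proof.
move=> a b ab; apply: val_inj; apply: (eq_bits (ltn_ord a) (ltn_ord b)) => t tk.
have tk' : (k.-1 - t < k)%N by lia.
have /setP/(_ (Ordinal tk')) := ab; rewrite !inE /bdigit /=.
by have -> : (k.-1 - (k.-1 - t))%N = t by lia.
Qed.

Lemma bits_bij : bijective bits.
Proof.
apply: (inj_card_bij bits_inj).
by rewrite card_ord -cardsT -powersetT card_powerset cardsT card_ord.
Qed.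

(** Inverse of [bits]; bijectivity keeps the default from being reached. *)
Definition num (S : {set 'I_k}) : 'I_(2 ^ k) :=
  odflt (Ordinal (expn_gt0 2 k : (0 < 2 ^ k)%N)) [pick r | bits r == S].

Lemma numK S : bits (num S) = S.
Proof.
rewrite /num; case: pickP => [r /eqP //|none].
have [g _ gK] := bits_bij.
by have := none (g S); rewrite gK eqxx.
Qed.

Lemma bitsK r : num (bits r) = r.
Proof. by apply: bits_inj; rewrite numK. Qed.

Definition flip t r := num (tog t (bits r)).
Definition diff p q := sd (bits p) (bits q).

Lemma flipK t : involutive (flip t).
Proof. by move=> r; rewrite /flip numK togK bitsK. Qed.

Lemma diff_flip t p q : diff (flip t p) (flip t q) = diff p q.
Proof. by rewrite /diff /flip !numK sd_tog. Qed.

Definition ports := ('I_k + 'I_k)%type.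

(* Reading order of the external nodes: rows i_1 ... i_k first, then the columns
   backwards, which are read off as i_n ... i_(n-k+1). *)
Definition port_rank (x : ports) : nat :=
  match x with inl t => t | inr t => k + (k.-1 - t) end.

Definition lpart (S : {set ports}) : {set 'I_k} := [set t | inl t \in S].
Definition rpart (S : {set ports}) : {set 'I_k} := [set t | inr t \in S].

Definition mxfun (F : fieldType) (A : 'M[F]_(2 ^ k)) (S : {set ports}) : F :=
  A (num (lpart S)) (num (rpart S)).

Definition joinp (P Q : {set 'I_k}) : {set ports} :=
  [set x | match x with inl t => t \in P | inr t => t \in Q end].

Lemma joinpK S : joinp (lpart S) (rpart S) = S.
Proof. by apply/setP=> -[t|t]; rewrite !inE. Qed.

Lemma lpart_join P Q : lpart (joinp P Q) = P.
Proof. by apply/setP=> t; rewrite !inE. Qed.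

Lemma rpart_join P Q : rpart (joinp P Q) = Q.
Proof. by apply/setP=> t; rewrite !inE. Qed.

Variable F : fieldType.
Implicit Types (A B : 'M[F]_(2 ^ k)).
Local Notation sgk := (sg F (@nat_of_ord k)).

Lemma mxfun_join A p q : mxfun A (joinp (bits p) (bits q)) = A p q.
Proof. by rewrite /mxfun lpart_join rpart_join !bitsK. Qed.

(** [B] is viewed as a tensor with two row indices; the operator is the row half of an identity. *)
Definition kernel_op B : 'M[F]_(2 ^ k) := \matrix_(p, q)
  (par F (diff p q) * (\sum_(t in diff p q) sgk t (diff p q) * B (flip t p) (flip t q))
   + (odd #|diff p q|)%:R * B p q).

(** The identity for the index pairs [(p, p')] and [(q, q')], its row half on the left and its
    column half on the right. *)
Definition intertwines A := forall p q p' q',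
  par F (diff p q) *
    (\sum_(t in diff p q) sgk t (diff p q) * (A (flip t p) p' * A (flip t q) q'))
  + (odd #|diff p q|)%:R * (A p p' * A q q')
  = par F (diff p' q') *
    (\sum_(t in diff p' q') sgk t (diff p' q') * (A p (flip t p') * A q (flip t q')))
  + (odd #|diff p' q'|)%:R * (A p p' * A q q').

Lemma congruenceE A B p q :
  (A *m B *m A^T) p q = \sum_i \sum_j A p i * A q j * B i j.
Proof.
rewrite mxE exchange_big /=; apply: eq_bigr => j _; rewrite !mxE big_distrl /=.
by apply: eq_bigr => i _; rewrite mulrAC.
Qed.

Lemma kernel_op_congr A B p q : kernel_op (A *m B *m A^T) p q =
  \sum_i \sum_j (par F (diff p q) *
    (\sum_(t in diff p q) sgk t (diff p q) * (A (flip t p) i * A (flip t q) j))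
  + (odd #|diff p q|)%:R * (A p i * A q j)) * B i j.
Proof.
rewrite mxE congruenceE; set D := diff p q.
rewrite [RHS](eq_bigr _ (fun i _ => eq_bigr _ (fun j _ => mulrDl _ _ _))) /=.
rewrite [RHS](eq_bigr _ (fun i _ => big_split _ _ _ _ _)) /= big_split /=.
congr (_ + _); last first.
  rewrite big_distrr /=; apply: eq_bigr => i _.
  by rewrite big_distrr /=; apply: eq_bigr => j _; rewrite mulrA.
transitivity (\sum_(t in D) \sum_i \sum_j
    par F D * (sgk t D * (A (flip t p) i * A (flip t q) j * B i j))).
  rewrite big_distrr /=; apply: eq_bigr => t _; rewrite congruenceE !big_distrr /=.
  by apply: eq_bigr => i _; rewrite !big_distrr.
rewrite exchange_big; apply: eq_bigr => i _; rewrite exchange_big; apply: eq_bigr => j _.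
by rewrite !big_distrr big_distrl /=; apply: eq_bigr => t _; ring.
Qed.

(** Reindexing both sums by [flip t] fixes [diff i j] and moves the flips from [B] to the columns of
    [A]. *)
Lemma congr_kernel_op A B p q : (A *m kernel_op B *m A^T) p q =
  \sum_i \sum_j (par F (diff i j) *
    (\sum_(t in diff i j) sgk t (diff i j) * (A p (flip t i) * A q (flip t j)))
  + (odd #|diff i j|)%:R * (A p i * A q j)) * B i j.
Proof.
rewrite congruenceE.
pose w i j t := if t \in diff i j then par F (diff i j) * sgk t (diff i j) else 0.
transitivity (\sum_i \sum_j (\sum_t w i j t * (A p i * A q j) * B (flip t i) (flip t j)
    + (odd #|diff i j|)%:R * (A p i * A q j) * B i j)).
  apply: eq_bigr => i _; apply: eq_bigr => j _; rewrite mxE mulrDr; congr (_ + _); last by ring.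
  rewrite !big_distrr /= big_mkcond /=; apply: eq_bigr => t _; rewrite /w.
  by case: ifP => _; [ring | rewrite !mul0r].
transitivity (\sum_i \sum_j (\sum_t w i j t * (A p (flip t i) * A q (flip t j)) * B i j
    + (odd #|diff i j|)%:R * (A p i * A q j) * B i j)); last first.
  apply: eq_bigr => i _; apply: eq_bigr => j _; rewrite mulrDl; congr (_ + _).
  rewrite !big_distrr /= big_distrl [RHS]big_mkcond /=; apply: eq_bigr => t _; rewrite /w.
  by case: ifP => _; [ring | rewrite !mul0r].
rewrite (eq_bigr _ (fun i _ => big_split _ _ _ _ _)) /=.
rewrite [RHS](eq_bigr _ (fun i _ => big_split _ _ _ _ _)) /= !big_split /=; congr (_ + _).
rewrite (eq_bigr _ (fun i _ => exchange_big _ _ _ _ _ _)) /= exchange_big /=.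
rewrite [RHS](eq_bigr _ (fun i _ => exchange_big _ _ _ _ _ _)) /= [RHS]exchange_big /=.
apply: eq_bigr => t _; rewrite (reindex_inj (inv_inj (flipK t))) /=; apply: eq_bigr => i _.
rewrite (reindex_inj (inv_inj (flipK t))) /=; apply: eq_bigr => j _.
by rewrite /w diff_flip !flipK.
Qed.

Lemma intertwinesP A :
  intertwines A <-> forall B, kernel_op (A *m B *m A^T) = A *m kernel_op B *m A^T.
Proof.
split=> [h B|h p q p' q'].
  apply/matrixP=> p q; rewrite kernel_op_congr congr_kernel_op.
  by apply: eq_bigr => i _; apply: eq_bigr => j _; rewrite h.
have pick (w : 'I_(2 ^ k) -> 'I_(2 ^ k) -> F) :
    \sum_i \sum_j w i j * delta_mx p' q' i j = w p' q'.
  rewrite (bigD1 p') //= (bigD1 q') //= mxE !eqxx mulr1 big1 ?addr0.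
    rewrite big1 ?addr0 // => i ip; apply: big1 => j _.
    by rewrite mxE (negPf ip) mulr0.
  by move=> j jq; rewrite mxE (negPf jq) andbF mulr0.
(* Elementary matrices isolate the coefficients of [B]. *)
have /matrixP/(_ p q) := h (delta_mx p' q').
by rewrite kernel_op_congr congr_kernel_op !pick.
Qed.

Lemma intertwines1 : intertwines 1%:M.
Proof. by apply/intertwinesP=> B; rewrite trmx1 !mulmx1 !mul1mx. Qed.

Lemma intertwinesM A B : intertwines A -> intertwines B -> intertwines (A *m B).
Proof.
move=> /intertwinesP hA /intertwinesP hB; apply/intertwinesP=> C.
have -> : A *m B *m C *m (A *m B)^T = A *m (B *m C *m B^T) *m A^T.
  by rewrite trmx_mul !mulmxA.
by rewrite hA hB trmx_mul !mulmxA.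
Qed.

Lemma intertwinesV A : A \in unitmx -> intertwines A -> intertwines (invmx A).
Proof.
move=> uA /intertwinesP hA; apply/intertwinesP=> C.
have uAT : A^T \in unitmx by rewrite unitmx_tr.
have := hA (invmx A *m C *m (invmx A)^T).
have -> : A *m (invmx A *m C *m (invmx A)^T) *m A^T = C.
  by rewrite !mulmxA mulmxV // mul1mx trmx_inv -mulmxA mulVmx // mulmx1.
move=> ->; rewrite trmx_inv !mulmxA mulVmx // mul1mx.
by rewrite -[RHS]mulmxA mulmxV // mulmx1.
Qed.

Lemma sg_inl t (D : {set ports}) : sg F port_rank (inl t) D = sgk t (lpart D).
Proof.
rewrite /sg big_sumType /= [X in _ * X]big1 ?mulr1; last first.
  by move=> s _; rewrite ltnNge ltnW ?andbF //; have := ltn_ord t; lia.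
by apply: eq_bigr => s _; rewrite inE.
Qed.

(** All row ports come first. The columns are reversed, so those before [t] are the larger ones:
    their sign is [par F (rpart D)] times that of the smaller ones, with a minus sign for [t]
    itself. *)
Lemma sg_inr t (D : {set ports}) : inr t \in D ->
  sg F port_rank (inr t) D = - (par F (lpart D) * par F (rpart D) * sgk t (rpart D)).
Proof.
move=> tD; rewrite /sg big_sumType /= -mulrA -mulrN; congr (_ * _).
  rewrite parE; apply: eq_bigr => s _; rewrite inE.
  by rewrite (_ : (s < _)%N) ?andbT //; have := ltn_ord s; lia.
have tR : t \in rpart D by rewrite inE.
have -> : - (par F (rpart D) * \prod_i (-1) ^+ ((i \in rpart D) && (i < t)%N))
   = par F (tog t (rpart D)) * \prod_i (-1) ^+ ((i \in rpart D) && (i < t)%N).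
  by rewrite -mulNr /par odd_card_tog; case: (odd _); rewrite /= ?expr0 ?expr1 ?opprK.
rewrite parE -big_split /=; apply: eq_bigr => s _; rewrite tog_in // in_setD1 !inE.
rewrite -signr_addb; congr (_ ^+ nat_of_bool _).
have [sD|_] := boolP (inr s \in D); last by rewrite andbF.
rewrite /= andbT ltn_add2l.
have -> : (s != t) = (s != t :> nat) by [].
have := ltn_ord s; have := ltn_ord t.
by move=> tk sk; apply/idP/idP; lia.
Qed.

Lemma mxfun_tog_inl A t P Q :
  mxfun A (tog (inl t) (joinp P Q)) = A (num (tog t P)) (num Q).
Proof.
rewrite /mxfun; congr (A (num _) (num _)); apply/setP=> s; rewrite !inE //.
by rewrite addbF.
Qed.

Lemma mxfun_tog_inr A t P Q :
  mxfun A (tog (inr t) (joinp P Q)) = A (num P) (num (tog t Q)).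
Proof.
rewrite /mxfun; congr (A (num _) (num _)); apply/setP=> s; rewrite !inE //.
by rewrite addbF.
Qed.

Lemma mgi_intertwines A : mgi port_rank (mxfun A) <-> intertwines A.
Proof.
have key p q p' q' :
   let P := joinp (bits p) (bits p') in let Q := joinp (bits q) (bits q') in
   \sum_(j in sd P Q) sg F port_rank j (sd P Q) * mxfun A (tog j P) * mxfun A (tog j Q)
   - (odd #|sd P Q|)%:R * mxfun A P * mxfun A Q
   = par F (diff p q) * (
     par F (diff p q) *
    (\sum_(t in diff p q) sgk t (diff p q) * (A (flip t p) p' * A (flip t q) q'))
  + (odd #|diff p q|)%:R * (A p p' * A q q')
  - (par F (diff p' q') *
    (\sum_(t in diff p' q') sgk t (diff p' q') * (A p (flip t p') * A q (flip t q')))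
  + (odd #|diff p' q'|)%:R * (A p p' * A q q'))).
  move=> P Q; set D := diff p q; set D' := diff p' q'.
  have sdE : sd P Q = joinp D D' by apply/setP=> -[t|t]; rewrite !inE.
  have oddE : odd #|sd P Q| = odd #|D| (+) odd #|D'|.
    rewrite sdE -oddD; congr odd.
    by rewrite -!sum1_card big_sumType /=; congr addn; apply: eq_bigl => t; rewrite inE.
  rewrite big_sumType /= !mxfun_join oddE sdE.
  have -> : \sum_(i | inl i \in joinp D D')
      sg F port_rank (inl i) (joinp D D') * mxfun A (tog (inl i) P) * mxfun A (tog (inl i) Q)
     = \sum_(t in D) sgk t D * (A (flip t p) p' * A (flip t q) q').
    apply: eq_big => t; first by rewrite inE.
    by rewrite sg_inl lpart_join !mxfun_tog_inl !bitsK mulrA.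
  have -> : \sum_(i | inr i \in joinp D D')
      sg F port_rank (inr i) (joinp D D') * mxfun A (tog (inr i) P) * mxfun A (tog (inr i) Q)
     = - (par F D * par F D') * \sum_(t in D') sgk t D' * (A p (flip t p') * A q (flip t q')).
    rewrite big_distrr /=; apply: eq_big => t; first by rewrite inE.
    move=> tD; rewrite sg_inr // lpart_join rpart_join !mxfun_tog_inr !bitsK.
    by rewrite !mulNr !mulrA.
  have pD := par_sqr F D; rewrite mulrBr !mulrDr !mulrA pD mul1r.
  (* True already over the integers; it splits the parity term into a column and a row
     contribution. *)
  have oE : ((odd #|D| (+) odd #|D'| : nat)%:R : F)
     = par F D * (odd #|D'|)%:R - par F D * (odd #|D|)%:R.
    by rewrite /par; do 2!case: (odd _); rewrite /= ?expr0 ?expr1; ring.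
  by rewrite oE; ring.
have nz (D : {set 'I_k}) : par F D != 0 by rewrite /par signr_eq0.
split=> [h p q p' q'|h P Q].
  have := key p q p' q'; rewrite /= h subrr => /esym/eqP.
  by rewrite mulf_eq0 (negPf (nz _)) subr_eq0 => /eqP.
have := key (num (lpart P)) (num (lpart Q)) (num (rpart P)) (num (rpart Q)).
by rewrite /= !numK !joinpK h subrr mulr0 => /eqP; rewrite subr_eq0 => /eqP.
Qed.

End Bits.

(** * Character matrices on the external nodes *)

(** Output ports count from the last node, the order in which the column string is read. *)
Definition ext_node k n (h : (k + k <= n)%N) (x : ports k) : 'I_n :=
  let w := widen_ord (leq_trans (leq_addr k k) h) in
  match x with inl t => w t | inr t => rev_ord (w t) end.

Lemma ext_node_inj k n (h : (k + k <= n)%N) : injective (ext_node h).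
Proof.
move=> [t|t] [s|s] /(congr1 val) /= e; have := ltn_ord t; have := ltn_ord s => sk tk;
  by [congr inl; apply: val_inj => /=; lia | congr inr; apply: val_inj => /=; lia | lia].
Qed.

Lemma ext_node_rank k n (h : (k + k <= n)%N) (x y : ports k) :
  (port_rank x < port_rank y)%N = (ext_node h x < ext_node h y)%N.
Proof.
by case: x y => [t|t] [s|s] /=; have := ltn_ord t; have := ltn_ord s; lia.
Qed.

Section GateMatrix.
Variables (F : fieldType) (k : nat) (Gamma : matchgate F).
Hypothesis kG : kbit k Gamma.
Local Notation n := (size_V Gamma).

Lemma kbit_size : (k + k <= n)%N.
Proof.
case: kG => cX cY _ _; rewrite -{1}cX -cY.
have := disj_in_out Gamma; rewrite -leq_card_setU => /eqP <-.
by rewrite -[leqRHS]card_ord max_card.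
Qed.

Lemma ext_node_in x : ext_node kbit_size x \in inputs Gamma :|: outputs Gamma.
Proof.
have hn := kbit_size; case: kG => _ _ -> ->; rewrite !inE.
by case: x => t /=; have := ltn_ord t; lia.
Qed.

Lemma character_mxE S :
  mxfun (character_mx k Gamma) S = character (ext_node kbit_size @: S).
Proof.
rewrite /mxfun mxE; congr character; have hn := kbit_size.
case: kG => _ _ -> ->; apply/setP=> j; rewrite !inE.
have bl t : bdigit k (num (lpart S)) (t : 'I_k) = (inl t \in S).
  by have /setP/(_ t) := numK (lpart S); rewrite !inE.
have br t : bdigit k (num (rpart S)) (t : 'I_k) = (inr t \in S).
  by have /setP/(_ t) := numK (rpart S); rewrite !inE.
have mem x : (ext_node kbit_size x \in ext_node kbit_size @: S) = (x \in S).
  by rewrite (mem_imset _ _ (@ext_node_inj _ _ _)).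
have [jk|kj] := ltnP j k.
  have -> : j = ext_node kbit_size (inl (Ordinal jk)) by apply: val_inj.
  rewrite mem -bl /=; have -> : (n - k <= j)%N = false by lia.
  by rewrite orbF.
rewrite /=; have [nj|jn] := leqP (n - k) j.
  have tk : (n - j.+1 < k)%N by have := ltn_ord j; lia.
  have -> : j = ext_node kbit_size (inr (Ordinal tk)).
    by apply: val_inj => /=; have := ltn_ord j; lia.
  rewrite mem -br /=; congr bdigit.
  by have := ltn_ord j; lia.
apply/esym/imsetP=> -[[t|t] _ je]; move: jn kj; rewrite je /=; have := ltn_ord t; lia.
Qed.

Lemma character_mx_mgi : mgi (@port_rank k) (mxfun (character_mx k Gamma)).
Proof.
have m := mgi_transport (@ext_node_inj _ _ kbit_size) (ext_node_rank kbit_size)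
   ext_node_in (character_mgi kG).
move=> P Q; have := m P Q; rewrite -!character_mxE => <-.
by apply: eq_bigr => j _; rewrite !character_mxE.
Qed.

End GateMatrix.

(** * Pfaffians at isolated nodes and leaves *)

Section PfaffianTools.
Variables (F : fieldType) (n : nat) (M : 'M[F]_n).
Hypotheses (Mskew : forall i j, M i j = - M j i) (Mdiag : forall i, M i i = 0).
Implicit Types (S : {set 'I_n}).
Local Notation sgn := (sg F (@nat_of_ord n)).

Lemma pf_row a S : a \in S -> pf M S = sgn a (tog a S) *
  \sum_(j in tog a S) sgn j (tog a S) * M a j * pf M (tog j (tog a S)).
Proof.
move=> aS; have := row_sumE Mskew Mdiag (tog a S) a.
rewrite in_tog eqxx aS /= togK /row_sum => ->.
by rewrite mulrA sg_sqr mul1r.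
Qed.

Lemma pf_isolated a S : a \in S -> (forall j, j \in S -> M a j = 0) -> pf M S = 0.
Proof.
move=> aS h; rewrite (pf_row aS) big1 ?mulr0 // => j.
by rewrite tog_in // in_setD1 => /andP[_ jS]; rewrite h // mulr0 mul0r.
Qed.

Lemma pf_leaf a b S : a \in S -> b \in S -> a != b ->
  (forall j, j \in S -> j != b -> M a j = 0) ->
  pf M S = sgn a (tog a S) * sgn b (tog a S) * M a b * pf M (tog b (tog a S)).
Proof.
move=> aS bS ab h; rewrite (pf_row aS) (bigD1 b) /=; last first.
  by rewrite in_tog bS eq_sym (negPf ab).
rewrite big1 ?addr0 ?mulrA // => j /andP[].
by rewrite tog_in // in_setD1 => /andP[_ jS] jb; rewrite h // mulr0 mul0r.
Qed.

Lemma pf_pair (a b : 'I_n) : (a < b)%N -> pf M [set a; b] = M a b.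
Proof.
move=> ab; have ne : a != b by apply: contraTneq ab => ->; rewrite ltnn.
have Ea : tog a [set a; b] = [set b].
  by apply/setP=> x; rewrite !inE; have [->|_] := eqVneq x a; rewrite ?(negPf ne) ?addbF.
rewrite (@pf_leaf a b) ?inE ?eqxx ?orbT //; last first.
  move=> j; rewrite !inE => /orP[/eqP ->|->//] _; exact: Mdiag.
have -> : tog b (tog a [set a; b]) = set0.
  by rewrite Ea; apply/setP=> x; rewrite !inE addbb.
rewrite Ea pf0 mulr1 !sg_min ?mul1r // => x; rewrite inE => /eqP -> //.
exact: ltnW.
Qed.

End PfaffianTools.

(** * Matchgates with prescribed local values *)

Lemma disjoint_mem (T : finType) (A B : {set T}) :
  (forall x, x \in A -> x \notin B) -> [disjoint A & B].
Proof. by move=> h; rewrite disjoint_subset; apply/subsetP=> x /h. Qed.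

(* In the gate below a pattern S of removed external nodes differs from S0 exactly at
   the "excited" v.  For v outside S0, [ext v] can only be matched with [inner v], so
   removing [ext v] frees [inner v]; for v in S0, restoring v frees [ext v] itself,
   while [inner v] is isolated, hence always omitted.  The nodes that can be freed are
   labelled [Some (Some v)] and joined to each other and to the omittable node [extra]
   (label [Some None]), which repairs the parity.  The weight between two of them is
   [omega] of the set of excited v that their labels name. *)
Section Realization.
Variables (F : fieldType) (k : nat) (S0 : {set ports k}) (v0 : ports k).
Hypothesis v0S0 : v0 \notin S0.
Local Notation N := (4 * k).+1.
Local Notation I := (ports k).
Local Notation node := ((I + I) + unit)%type.
Local Notation ext v := (inl (inl v) : node).
Local Notation inner v := (inl (inr v) : node).
Local Notation extra := (inr tt : node).

(** Being a k-bit gate dictates the positions of the external nodes. The order of the nodes between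
    them only affects signs, which are absorbed when the weights are chosen. *)
Definition node_pos (x : node) : nat :=
  match x with
  | inl (inl (inl t)) => t
  | inl (inl (inr t)) => 4 * k - t
  | inl (inr (inl t)) => k + t
  | inl (inr (inr t)) => 2 * k + t
  | inr _ => 3 * k
  end.

Definition enc (x : node) : 'I_N := inord (node_pos x).

Lemma encE x : enc x = node_pos x :> nat.
Proof.
rewrite inordK //; case: x => [[[t|t]|[t|t]]|[]] /=; try have := ltn_ord t; lia.
Qed.

Lemma enc_inj : injective enc.
Proof.
move=> x y /(congr1 (@nat_of_ord N)); rewrite !encE.
case: x y => [[[t|t]|[t|t]]|[]] [[[s|s]|[s|s]]|[]] //= e;
  try (have tk := ltn_ord t); try (have sk := ltn_ord s); try (exfalso; lia).
- by have -> : t = s by apply: val_inj => /=; lia.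
- by have -> : t = s by apply: val_inj => /=; lia.
- by have -> : t = s by apply: val_inj => /=; lia.
by have -> : t = s by apply: val_inj => /=; lia.
Qed.

Lemma enc_bij : bijective enc.
Proof.
apply: (inj_card_bij enc_inj).
by rewrite !card_sum !card_ord card_unit; lia.
Qed.

Definition dec (i : 'I_N) : node := odflt extra [pick x | enc x == i].

Lemma encK : cancel enc dec.
Proof.
move=> x; rewrite /dec; case: pickP => [y /eqP/enc_inj ->//|/(_ x)].
by rewrite eqxx.
Qed.

Lemma decK : cancel dec enc.
Proof. by move=> i; have [g gK hK] := enc_bij; rewrite -(hK i) encK. Qed.

Lemma mem_enc x (A : {set node}) : (enc x \in enc @: A) = (x \in A).
Proof. exact: (mem_imset _ _ enc_inj). Qed.

Lemma enc_set (A : {set node}) (B : {set 'I_N}) :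
  (forall x, (enc x \in B) = (x \in A)) -> B = enc @: A.
Proof. by move=> h; apply/setP=> i; rewrite -(decK i) mem_enc h. Qed.

Definition label (x : node) : option (option I) :=
  match x with
  | inl (inl v) => if v \in S0 then Some (Some v) else None
  | inl (inr v) => if v \in S0 then None else Some (Some v)
  | inr _ => Some None
  end.

Definition label_pair (a b : option I) : {set I} :=
  [set v | (Some v == a) || (Some v == b)].

Section Weights.
Variables (eta : F) (omega : {set I} -> F).

(** The edge at [v0] carries [eta], the free scale of the gate: at the pattern [S0] all these edges
    are used. *)
Definition pair_weight (u v : I) : F :=
  if (u == v) && (u \notin S0) then (if u == v0 then eta else 1) else 0.

Definition node_weight (x y : node) : F :=
  match label x, label y with
  | Some a, Some b => omega (label_pair a b)
  | _, _ => match x, y with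
            | inl (inl u), inl (inr v) => pair_weight u v
            | inl (inr v), inl (inl u) => pair_weight u v
            | _, _ => 0
            end
  end.

Lemma node_weightC x y : node_weight x y = node_weight y x.
Proof.
rewrite /node_weight; case: (label x) (label y) => [a|] [b|] //.
- by congr omega; apply/setP=> v; rewrite !inE orbC.
- by case: x y => [[?|?]|?] [[?|?]|?].
- by case: x y => [[?|?]|?] [[?|?]|?].
by case: x y => [[?|?]|?] [[?|?]|?].
Qed.

Definition gate_weight (i j : 'I_N) : F :=
  if i != j then node_weight (dec i) (dec j) else 0.

Lemma complete_sym : symmetric (fun i j : 'I_N => i != j).
Proof. by move=> i j; rewrite eq_sym. Qed.

Lemma complete_irr : irreflexive (fun i j : 'I_N => i != j).
Proof. by move=> i; rewrite eqxx. Qed.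

Lemma gate_weight_sym i j : gate_weight i j = gate_weight j i.
Proof. by rewrite /gate_weight eq_sym node_weightC. Qed.

Lemma gate_weight_absent i j : ~~ (i != j) -> gate_weight i j = 0.
Proof. by rewrite /gate_weight => /negPf ->. Qed.

Definition gate_graph : wgraph F N :=
  WGraph complete_sym complete_irr gate_weight_sym gate_weight_absent.

Definition gate_inputs : {set 'I_N} := [set i : 'I_N | (i < k)%N].
Definition gate_outputs : {set 'I_N} := [set i : 'I_N | (N - k <= i)%N].
Definition gate_omittable : {set 'I_N} :=
  enc @: [set x : node | match x with
                  | inl (inl _) => false
                  | inl (inr v) => v \in S0
                  | inr _ => true end].

Lemma gate_in_out : [disjoint gate_inputs & gate_outputs].
Proof.
rewrite -setI_eq0; apply/eqP/setP=> i; rewrite !inE.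
by apply/negP=> /andP[]; lia.
Qed.

Lemma gate_omittable_pos (i : 'I_N) : i \in gate_omittable -> (k <= i < N - k)%N.
Proof.
case/imsetP=> -[[v|v]|[]]; rewrite inE // => _ ->; rewrite encE /=; last lia.
by case: v => t; have := ltn_ord t; lia.
Qed.

Lemma gate_in_omit : [disjoint gate_inputs & gate_omittable].
Proof.
rewrite disjoint_sym; apply: disjoint_mem => i /gate_omittable_pos; rewrite inE; lia.
Qed.

Lemma gate_out_omit : [disjoint gate_outputs & gate_omittable].
Proof.
rewrite disjoint_sym; apply: disjoint_mem => i /gate_omittable_pos; rewrite inE; lia.
Qed.

Definition gate : matchgate F :=
  @Matchgate F N gate_graph gate_inputs gate_outputs gate_omittable
    gate_in_out gate_in_omit gate_out_omit.

Lemma gate_kbit : kbit k gate.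
Proof.
have kN : (k <= N)%N by lia.
split=> //=.
  rewrite (_ : gate_inputs = widen_ord kN @: setT).
    by rewrite card_imset ?cardsT ?card_ord // => i j /(congr1 val) /= ?; apply: val_inj.
  apply/setP=> i; rewrite inE; apply/idP/imsetP => [ik|[t _ ->]]; last exact: (ltn_ord t).
  by exists (Ordinal ik) => //; apply: val_inj.
rewrite (_ : gate_outputs = (@rev_ord N \o widen_ord kN) @: setT).
  rewrite card_imset ?cardsT ?card_ord // => i j /rev_ord_inj /(congr1 val) /= ?; exact: val_inj.
apply/setP=> i; rewrite inE; apply/idP/imsetP => [ik|[t _ ->]].
  have tk : (N - i.+1 < k)%N by have := ltn_ord i; lia.
  by exists (Ordinal tk) => //; apply: val_inj => /=; have := ltn_ord i; lia.
by rewrite /=; have := ltn_ord t; lia.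
Qed.

Local Notation M := (skew_adj gate_graph).

Lemma skew_enc x y : x != y ->
  M (enc x) (enc y) = (-1) ^+ (enc y < enc x)%N * node_weight x y.
Proof.
move=> xy; have ne : enc x != enc y by rewrite (inj_eq enc_inj).
rewrite mxE /= /gate_weight ne !encK; have: enc x != enc y :> nat by [].
by case: ltngtP => // _ _; rewrite ?expr0 ?expr1 ?mul1r ?mulN1r.
Qed.

Lemma pf_enc_pair x y : x != y -> pf M (enc @: [set x; y]) = node_weight x y.
Proof.
move=> xy; rewrite imsetU1 imset_set1.
have sk := @skew_adj_skew F gate; have dg := @skew_adj_diag F gate.
have ne : enc x != enc y by rewrite (inj_eq enc_inj).
have: enc x != enc y :> nat by [].
case: ltngtP => // lt _.
  by rewrite (pf_pair sk dg) //= skew_enc // ltnNge ltnW // mul1r.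
by rewrite setUC (pf_pair sk dg) //= skew_enc 1?eq_sym // ltnNge ltnW // mul1r node_weightC.
Qed.

End Weights.

Definition pair_nodes (U : {set I}) : {set node} :=
  [set x : node | match x with inl (inl v) => v \in U | inl (inr v) => v \in U | inr _ => false end].

Lemma pair_nodes_tog v (U : {set I}) :
  pair_nodes (tog v U) = tog (inner v) (tog (ext v) (pair_nodes U)).
Proof.
apply/setP=> -[[u|u]|[]]; rewrite !inE ?addbF //.
Qed.

Lemma odd_pair_nodes U : odd #|pair_nodes U| = false.
Proof.
elim/tog_ind: U => [|v U _ IH]; last by rewrite pair_nodes_tog !odd_card_tog negbK.
by rewrite (_ : pair_nodes set0 = set0) ?cards0 //; apply/setP=> -[[u|u]|[]]; rewrite !inE.
Qed.

Lemma enc_tog x (A : {set node}) : enc @: tog x A = tog (enc x) (enc @: A).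
Proof.
apply/esym/enc_set=> y; by rewrite !in_tog mem_enc (inj_eq enc_inj).
Qed.

Definition eta_factor (eta : F) (U : {set I}) : F := if v0 \in U then eta else 1.

(* [delta] must not depend on the weights, which are chosen after it. *)
Lemma pf_remove_pairs (U : {set I}) (E : {set node}) :
  (forall v, v \in U -> [/\ v \notin S0, ext v \notin E & inner v \notin E]) ->
  exists2 delta : F, delta != 0 & forall eta omega,
    pf (skew_adj (gate_graph eta omega)) (enc @: sd (pair_nodes U) E)
    = delta * eta_factor eta U * pf (skew_adj (gate_graph eta omega)) (enc @: E).
Proof.
elim/tog_ind: U => [_|v U vU IH UE].
  exists 1; first exact: oner_neq0.
  move=> eta omega; rewrite /eta_factor inE !mul1r.
  rewrite (_ : sd (pair_nodes set0) E = E) //.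
  by apply/setP=> -[[u|u]|[]]; rewrite !inE.
have [|delta d0 dE] := IH.
  by move=> u uU; apply: UE; rewrite in_tog uU; case: eqVneq uU vU => // -> ->.
have [vS vE1 vE2] : [/\ v \notin S0, ext v \notin E & inner v \notin E].
  by apply: UE; rewrite in_tog eqxx (negPf vU).
set S := enc @: sd (pair_nodes (tog v U)) E.
set a := enc (ext v); set b := enc (inner v).
have aS : a \in S by rewrite mem_enc !inE eqxx (negPf vU) (negPf vE1).
have bS : b \in S by rewrite mem_enc !inE eqxx (negPf vU) (negPf vE2).
have ab : a != b by rewrite (inj_eq enc_inj).
(* [ext v] is a leaf attached to [inner v]; its signs go into [delta], and its weight into
   [eta_factor]. *)
exists (sg F (@nat_of_ord N) a (tog a S) * sg F (@nat_of_ord N) b (tog a S)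
        * (-1) ^+ (b < a)%N * delta).
  by rewrite !mulf_neq0 ?sg_neq0 ?signr_eq0.
move=> eta omega.
have wE y : node_weight eta omega (ext v) y
    = if y == inner v then (if v == v0 then eta else 1) else 0.
  rewrite /node_weight /= (negPf vS).
  by case: y => [[u|u]|[]] //=; rewrite /pair_weight vS andbT eq_sym.
rewrite (pf_leaf (@skew_adj_skew _ (gate eta omega)) (@skew_adj_diag _ (gate eta omega)) aS bS ab).
  have -> : tog b (tog a S) = enc @: sd (pair_nodes U) E.
    by rewrite /S pair_nodes_tog !tog_sdl !enc_tog -/a -/b togC togK togK.
  rewrite dE skew_enc // wE eqxx.
  have -> : eta_factor eta (tog v U) = (if v == v0 then eta else 1) * eta_factor eta U.
    rewrite /eta_factor in_tog [v0 == v]eq_sym; case: eqVneq => [<-|_].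
      by rewrite (negPf vU) mulr1.
    by rewrite addbF mul1r.
  by rewrite -!/a -!/b; ring.
move=> j _ jb; rewrite -(decK j); have [->|ne] := eqVneq (dec j) (ext v).
  exact: (@skew_adj_diag _ (gate eta omega)).
rewrite skew_enc 1?eq_sym // wE; case: eqVneq => [e|_]; last by rewrite mulr0.
by move: jb; rewrite -(decK j) e eqxx.
Qed.

Section Patterns.
Variable W : {set I}.
Local Notation D := (sd S0 W).

Definition excited : {set node} :=
  [set x : node | match x with
           | inl (inl v) => (v \in S0) && (v \in D)
           | inl (inr v) => (v \notin S0) && (v \in D)
           | inr _ => odd #|D| end].

Lemma odd_excited : odd #|excited| = false.
Proof.
rewrite -sum1_card big_sumType /= big_sumType /=.
have -> : (\sum_(v | ext v \in excited) 1 = \sum_(v in D | v \in S0) 1)%N.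
  by apply: eq_bigl => v; rewrite !inE andbC.
have -> : (\sum_(v | inner v \in excited) 1 = \sum_(v in D | v \notin S0) 1)%N.
  by apply: eq_bigl => v; rewrite !inE andbC.
rewrite -bigID sum1_card big_mkcond /= (big_pred1 tt) => [|[]//].
by rewrite !inE; case: ifP => o; rewrite ?addn0 ?addn1 /= o.
Qed.

Definition unexcited : {set I} := ~: (S0 :|: W).

Definition remaining : {set node} := sd (pair_nodes unexcited) excited.

Lemma ext_remaining v : (ext v \in remaining) = (v \notin W).
Proof. by rewrite !inE; case: (v \in S0); case: (v \in W). Qed.

Lemma inner_remaining v : (inner v \in remaining) = (v \notin S0).
Proof. by rewrite !inE; case: (v \in S0); case: (v \in W). Qed.

(** Only one omitted set can contribute: for [v] in [S0] the node [inner v] is isolated and must be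
    omitted, and parity then decides about [extra]. *)
Lemma remaining_pairs eta omega :
  PfS (gate_graph eta omega) gate_omittable (enc @: [set ext v | v in W])
  = pf (skew_adj (gate_graph eta omega)) (enc @: remaining).
Proof.
set M := skew_adj _; set R := enc @: remaining; set Z := enc @: [set ext v | v in W].
have memZ v : (enc (ext v) \in Z) = (v \in W).
  by rewrite mem_enc (mem_imset _ _ (inj_comp inl_inj inl_inj)).
have memZ' x : enc x \in Z -> exists v, x = ext v.
  by rewrite mem_enc => /imsetP[v _ ->]; exists v.
have memR x : (enc x \in R) = (x \in remaining) by rewrite mem_enc.
have ZR : [disjoint Z & R].
  apply: disjoint_mem => i; rewrite -(decK i) => /[dup] /memZ' [v ->].
  by rewrite memZ memR ext_remaining negbK.
have oddR : odd #|R| = false.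
  by rewrite card_imset ?odd_card_sd ?odd_pair_nodes ?odd_excited //; exact: enc_inj.
have memT x : (enc x \in gate_omittable) = match x with
      inl (inl _) => false | inl (inr v) => v \in S0 | inr _ => true end.
  by rewrite mem_enc inE.
have ZT (A : {set 'I_N}) : A \subset gate_omittable -> [disjoint Z & A].
  move=> /subsetP AT; apply: disjoint_mem => i; rewrite -(decK i) => /memZ' [v ->].
  by apply/negP=> /AT; rewrite memT.
have only (A : {set 'I_N}) : A \subset gate_omittable ->
    pf M (~: (Z :|: A)) != 0 -> ~: (Z :|: A) = R.
  move=> AT nz; have inA v : v \in S0 -> enc (inner v) \in A.
    move=> vS; apply: contraNT nz => vA; apply/eqP.
    have vB : enc (inner v) \in ~: (Z :|: A).
      rewrite in_setC in_setU negb_or vA andbT; apply/negP=> /memZ' [u] //.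
    apply: (pf_isolated (@skew_adj_skew _ (gate eta omega)) (@skew_adj_diag _ (gate eta omega)) vB).
    move=> j jB; rewrite -(decK j).
    have [->|ne] := eqVneq (dec j) (inner v).
      exact: (@skew_adj_diag _ (gate eta omega)).
    rewrite skew_enc 1?eq_sym // /node_weight /= vS.
    case: (dec j) => [[u|u]|[]]; rewrite /= ?mulr0 //.
    rewrite /pair_weight; case: eqVneq => [->|]; rewrite ?vS /= ?mulr0 //.
  have same x : x != extra -> (enc x \in ~: (Z :|: A)) = (enc x \in R).
    rewrite in_setC in_setU negb_or memR; case: x => [[v|v]|[]] // _.
      rewrite memZ ext_remaining; have : enc (ext v) \notin A.
        by apply/negP=> /(subsetP AT); rewrite memT.
      by move=> ->; rewrite andbT.
    rewrite inner_remaining; have -> /= : enc (inner v) \notin Z by apply/negP=> /memZ' [].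
    have [vS|vS] := boolP (v \in S0); first by rewrite inA.
    by apply/negP=> /(subsetP AT); rewrite memT (negPf vS).
  have [e|ne] := eqVneq (enc extra \in ~: (Z :|: A)) (enc extra \in R).
    apply/setP=> i; rewrite -(decK i); have [->//|] := eqVneq (dec i) extra; exact: same.
  have BE : ~: (Z :|: A) = tog (enc extra) R.
    apply/setP=> i; rewrite -(decK i) in_tog (inj_eq enc_inj).
    have [->|h] := eqVneq (dec i) extra; last by rewrite addbF same.
    by move: ne; do 2!case: (_ \in _).
  by move: nz; rewrite BE pf_odd ?eqxx // odd_card_tog oddR.
have CZR : ~: (Z :|: ~: (Z :|: R)) = R.
  apply/setP=> i; rewrite !inE negb_or negbK; have [iZ|//] := boolP (i \in Z).
  by rewrite (disjointFr ZR iZ).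
rewrite /PfS (bigD1 (~: (Z :|: R))) /=; last first.
  apply/subsetP=> i; rewrite -(decK i) in_setC in_setU negb_or memT.
  case: (dec i) => [[v|v]|[]] //; first by rewrite memZ memR ext_remaining => /andP[/negPf ->].
  by rewrite memR inner_remaining negbK => /andP[].
rewrite -pf_setC CZR big1 ?addr0 // => A /andP[AT neA].
rewrite -pf_setC; apply/eqP; apply: contraNT neA => /(only A AT) BR.
apply/eqP/setP=> i; have /setP/(_ i) := BR; rewrite !inE => <-.
have [iZ|iZ] := boolP (i \in Z); first by rewrite (disjointFr (ZT A AT) iZ).
by rewrite negbK.
Qed.

End Patterns.

(** What is left is empty, a freed node with [extra], or two freed nodes, so the Pfaffian is 1 or a
    single weight. *)
Lemma pf_excited eta omega W : (#|sd S0 W| <= 2)%N ->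
  pf (skew_adj (gate_graph eta omega)) (enc @: excited W)
  = if sd S0 W == set0 then 1 else omega (sd S0 W).
Proof.
have lab v : label (if v \in S0 then ext v else inner v) = Some (Some v).
  by case: ifP => /= ->.
have lp_ne v (x : node) : label x != Some (Some v) ->
    (if v \in S0 then ext v else inner v) != x.
  by apply: contraNneq => <-; rewrite lab.
set D := sd S0 W => D2; have exE : excited W = [set x : node | match x with
           | inl (inl v) => (v \in S0) && (v \in D)
           | inl (inr v) => (v \notin S0) && (v \in D)
           | inr _ => odd #|D| end] by [].
move: D D2 exE => D D2 exE.
have [D0|D0] := eqVneq D set0.
  rewrite (_ : excited W = set0) ?imset0 ?pf0 //.
  by rewrite exE D0; apply/setP=> -[[v|v]|[]]; rewrite !inE ?andbF ?cards0.
have c12 : (#|D| == 1%N) || (#|D| == 2%N).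
  by move: D2; rewrite leq_eqVlt ltnS leq_eqVlt ltnS leqn0 cards_eq0 (negPf D0) orbF orbC.
case/orP: c12 => [/cards1P[i DE]|/cards2P[i [j [ij DE]]]].
  have -> : excited W = [set (if i \in S0 then ext i else inner i); extra].
    rewrite exE DE cards1; apply/setP=> -[[v|v]|[]]; rewrite !inE ?orbT ?orbF //.
      have [->|ne] := eqVneq v i; first by case: ifP; rewrite ?eqxx.
      rewrite andbF; case: ifP => // _; apply/esym/eqP=> -[] e; by rewrite e eqxx in ne.
    have [->|ne] := eqVneq v i; first by case: ifP; rewrite ?eqxx.
    rewrite andbF; case: ifP => // _; apply/esym/eqP=> -[] e; by rewrite e eqxx in ne.
  rewrite pf_enc_pair; last exact: lp_ne.
  rewrite /node_weight lab /=; congr omega; rewrite DE.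
  by apply/setP=> v; rewrite !inE orbF.
have -> : excited W = [set (if i \in S0 then ext i else inner i);
                           (if j \in S0 then ext j else inner j)].
  rewrite exE DE cards2 ij; apply/setP=> x; rewrite !inE.
  have pe u : (x == (if u \in S0 then ext u else inner u))
     = match x with inl (inl v) => (v \in S0) && (v == u)
                | inl (inr v) => (v \notin S0) && (v == u) | inr _ => false end.
    case: x => [[v|v]|[]]; last by case: ifP.
      have [->|h] := eqVneq v u; first by case: ifP; rewrite ?eqxx.
      rewrite andbF; case: ifP => // _; apply/eqP=> -[] e; by rewrite e eqxx in h.
    have [->|h] := eqVneq v u; first by case: ifP; rewrite ?eqxx.
    rewrite andbF; case: ifP => // _; apply/eqP=> -[] e; by rewrite e eqxx in h.
  by rewrite !pe; case: x {pe} => [[v|v]|[]]; rewrite ?inE -?andb_orr.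
rewrite pf_enc_pair; last by apply: lp_ne; rewrite lab; apply: contraNneq ij => -[->].
rewrite /node_weight !lab; congr omega; rewrite DE.
by apply/setP=> v; rewrite !inE.
Qed.

Lemma realization (g : {set I} -> F) : g S0 != 0 ->
  exists2 Gamma : matchgate F, kbit k Gamma &
    forall S, (#|sd S0 S| <= 2)%N -> mxfun (character_mx k Gamma) S = g S.
Proof.
move=> gS0.
have extE eta omega v :
    ext_node (kbit_size (gate_kbit eta omega)) v = enc (ext v).
  by apply: val_inj; rewrite /= encE; case: v => t //=; have := ltn_ord t; lia.
(* The sign [eps] depends on the pattern alone, so the weights can be solved for afterwards without
   circularity. *)
have sign S : exists eps : F, eps != 0 /\
    forall eta omega, (#|sd S0 S| <= 2)%N ->
    mxfun (character_mx k (gate eta omega)) S = eps * eta_factor eta (unexcited S)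
      * (if sd S0 S == set0 then 1 else omega (sd S0 S)).
  have [|delta d0 dE] := @pf_remove_pairs (unexcited S) (excited S).
    move=> v; rewrite !inE negb_or => /andP[/negPf vS /negPf vW].
    by rewrite vS vW.
  exists (ext_sign F gate_inputs (enc @: [set ext v | v in S]) * delta); split.
    rewrite mulf_neq0 // /ext_sign; apply/prodf_neq0=> z _; apply/prodf_neq0=> j _.
    by rewrite signr_eq0.
  move=> eta omega S2; rewrite (character_mxE (gate_kbit eta omega)).
  have -> : ext_node (kbit_size (gate_kbit eta omega)) @: S = enc @: [set ext v | v in S].
    by rewrite -imset_comp; apply: eq_imset => v; exact: extE.
  rewrite (character_ext_sign (gate_kbit eta omega)) /=; last first.
    apply/subsetP=> _ /imsetP[_ /imsetP[v _ ->] ->]; rewrite -(extE eta omega).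
    exact: (ext_node_in (gate_kbit eta omega)).
  by rewrite remaining_pairs dE pf_excited // !mulrA.
have [eps epsE] := fin_all_exists sign.
(* At [S0] the gate yields [eps S0 * eta]; at distance 1 or 2 it yields a nonzero factor times
   [omega], so each value is met by one division. *)
pose eta := g S0 / eps S0.
pose omega D := g (sd S0 D) / (eps (sd S0 D) * eta_factor eta (unexcited (sd S0 D))).
have eta0 : eta != 0 by rewrite mulf_neq0 // invr_eq0; case: (epsE S0).
exists (gate eta omega) => [|S S2]; first exact: gate_kbit.
have [e0 ->//] := epsE S; case: eqVneq => [D0|_].
  have -> : S = S0.
    by rewrite -(sdKl S0 S) D0; apply/setP=> x; rewrite !inE addbF.
  rewrite /eta_factor !inE (negPf v0S0) /= mulr1 mulrC divfK //.
  by case: (epsE S0).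
rewrite /omega sdKl mulrC divfK // mulf_neq0 // /eta_factor.
by case: ifP => // _; exact: oner_neq0.
Qed.

End Realization.

(** * Nonsingular character matrices *)

Lemma unitmx_row_neq0 (F : fieldType) m (A : 'M[F]_m) i :
  A \in unitmx -> exists j, A i j != 0.
Proof.
move=> uA; apply/existsP; apply: contraT => /existsPn h.
have r0 : row i A = 0.
  by apply/rowP=> j; rewrite !mxE; apply/eqP; have := h j; rewrite negbK.
have := congr1 (fun B => B *m invmx A) r0; rewrite mul0mx -row_mul mulmxV //.
by move=> /rowP/(_ i); rewrite !mxE eqxx => /eqP; rewrite oner_eq0.
Qed.

Lemma character_mxP (F : fieldType) k (hk : (0 < k)%N) (A : 'M[F]_(2 ^ k)) :
  A \in unitmx -> is_character_mx A <-> intertwines A.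
Proof.
move=> uA; rewrite -mgi_intertwines; split=> [[Gamma [kG ->]]|mA].
  exact: character_mx_mgi.
have [q Aq] := unitmx_row_neq0 (num set0) uA.
(* The empty row part leaves every row port outside [S0], as needed for [v0]. *)
pose S0 := joinp set0 (bits q).
have gS0 : mxfun A S0 != 0 by rewrite /S0 -(numK set0) mxfun_join.
have v0S0 : inl (Ordinal hk) \notin S0 by rewrite !inE.
have [Gamma kG near] := realization v0S0 gS0.
exists Gamma; split=> //; apply/matrixP=> r c.
rewrite -!mxfun_join; apply/esym; move: (joinp _ _).
apply: (mgi_unique (character_mx_mgi kG) mA (S0 := S0)) => //.
by rewrite near // (_ : sd S0 S0 = set0) ?cards0 //; apply/setP=> x; rewrite !inE addbb.
Qed.

Theorem theorem3p1 (F : fieldType) (k : nat) (hk : (0 < k)%N) :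
  forms_group (fun A B : 'M[F]_(2 ^ k) => (A *m B)%R)
    (fun A : 'M[F]_(2 ^ k) => A \in unitmx /\ is_character_mx A).
Proof.
have chP := @character_mxP F k hk; split.
- move=> A B [uA /(chP A uA) cA] [uB /(chP B uB) cB].
  have uAB : A *m B \in unitmx by rewrite unitmx_mul uA.
  by split=> //; apply/(chP _ uAB); exact: intertwinesM.
- by move=> A B C _ _ _; exact: mulmxA.
exists 1%:M; split.
- by split; [exact: unitmx1 | apply/(chP _ (unitmx1 _ _)); exact: intertwines1].
- by move=> A _; rewrite mul1mx mulmx1.
move=> A [uA /(chP A uA) cA]; exists (invmx A).
have uV : invmx A \in unitmx by rewrite unitmx_inv.
split; [|exact: mulmxV|exact: mulVmx].
by split=> //; apply/(chP _ uV); exact: intertwinesV.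
Qed.
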